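(* There exists a minimal subshift $(X,T)$ and an ergodic measure $\mu\in\mathcal{M}_T(X)$ such that $G_\mu$ is $\boldsymbol{\Pi}^0_3$-complete.
   Context: A subshift is a pair $(X,T)$ where $X$ is a nonempty closed subset of $A^{\omega}$ ($A$ a finite alphabet with the discrete topology, $A^\omega$ with the product topology, $\omega=\{0,1,2,\dots\}$), $T$ is the shift map $(Tx)_i=x_{i+1}$ and $T(X)\subseteq X$. $(X,T)$ is minimal if $\overline{\{T^n x:n\ge0\}}=X$ for every $x\in X$. $\mathcal{M}_T(X)$ is the set of $T$-invariant Borel probability measures on $X$. $G_\mu$ is the set of generic points of $\mu$: those $x\in X$ for which $\frac1n\sum_{j=0}^{n-1}\delta_{T^j(x)}\to\mu$ in the weak$^*$ topology as $n\to\infty$. Borel hierarchy: $\boldsymbol{\Sigma}^0_1$ = open sets, $\boldsymbol{\Pi}^0_n$ = complements of $\boldsymbol{\Sigma}^0_n$ sets, $\boldsymbol{\Sigma}^0_{n+1}$ = countable unions of $\boldsymbol{\Pi}^0_n$ sets. $A\subseteq X$ is $\boldsymbol{\Pi}^0_3$-complete if $A\in\boldsymbol{\Pi}^0_3\setminus\boldsymbol{\Sigma}^0_3$. *)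

(* Defs.v *)
From HB Require Import structures.
From mathcomp Require Import all_boot all_order all_algebra.
From mathcomp Require Import all_classical all_reals all_analysis.
Import Order.TTheory GRing.Theory Num.Theory.
Import numFieldNormedType.Exports.
Set Implicit Arguments.
Unset Strict Implicit.
Unset Printing Implicit Defensive.
Local Open Scope classical_set_scope.
Local Open Scope ring_scope.

(* Levels are numbered from 1 as usual; level 0 is not part of the hierarchy
   and is left empty. *)
Fixpoint Sigma0 (T : topologicalType) (n : nat) (S : set T) : Prop :=
  match n with
  | 0 => False
  | 1 => open S
  | (_.+1 as m).+1 =>
      exists2 F : (set T)^nat,
        (forall i, Sigma0 m (~` F i)) & S = \bigcup_i F i
  end.

Definition Pi0 (T : topologicalType) (n : nat) (S : set T) : Prop :=
  Sigma0 n (~` S).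

Definition Pi03_complete (T : topologicalType) (S : set T) : Prop :=
  Pi0 3 S /\ ~ Sigma0 3 S.

Definition full_shift (A : finType) : Type := {ptws nat -> discrete_topology A}.

HB.instance Definition _ (A : finType) := Topological.on (full_shift A).

Definition shift (A : finType) (x : full_shift A) : full_shift A :=
  fun i => x i.+1.

Record subshift (A : finType) := Subshift {
  subshift_set : set (full_shift A);
  subshift_nonempty : subshift_set !=set0;
  subshift_closed : closed subshift_set;
  subshift_shift : @shift A @` subshift_set `<=` subshift_set
}.

Definition subshift_type (A : finType) (X : subshift A) : Type :=
  set_type (subshift_set X).
Coercion subshift_type : subshift >-> Sortclass.

Section subshift_dynamics.
Variables (A : finType) (X : subshift A).

HB.instance Definition _ := Topological.copy X (set_type (subshift_set X)).

(* The library's measurable types are pointed, so an arbitrary point of X is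
   chosen. *)
Definition base_point : X :=
  let x := cid (subshift_nonempty X) in
  exist _ (projT1 x) (mem_set (projT2 x)).
HB.instance Definition _ := isPointed.Build X base_point.

Lemma shift_in (x : X) : shift (set_val x) \in subshift_set X.
Proof.
apply/mem_set/subshift_shift; exists (set_val x) => //.
exact/set_mem/(valP x).
Qed.

Definition subshift_map (x : X) : X := exist _ (shift (set_val x)) (shift_in x).

Definition minimal_subshift : Prop :=
  forall x : X, closure [set iter n subshift_map x | n in [set: nat]] = [set: X].

Definition borel : Type := g_sigma_algebraType (@open X).

HB.instance Definition _ := Measurable.on borel.

Variable R : realType.

Definition shift_invariant (mu : probability borel R) : Prop :=
  forall B : set borel, measurable B -> mu (subshift_map @^-1` B) = mu B.

Definition ergodic (mu : probability borel R) : Prop :=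
  shift_invariant mu /\
  forall B : set borel, measurable B -> subshift_map @^-1` B = B ->
    mu B = 0%E \/ mu B = 1%E.

Definition weak_star_cvg (m : nat -> {measure set borel -> \bar R})
    (mu : {measure set borel -> \bar R}) : Prop :=
  forall f : X -> R, continuous f ->
    (\int[m n]_x (f x)%:E)%E @[n --> \oo] --> (\int[mu]_x (f x)%:E)%E.

Definition empirical (x : X) (n : nat) : {measure set borel -> \bar R} :=
  mscale (n%:R^-1)%:nng
    (msum (fun j => \d_(iter j subshift_map x : borel)) n).

Definition generic_points (mu : probability borel R) : set X :=
  [set x | weak_star_cvg (empirical x) mu].

End subshift_dynamics.

(* Main.v *)
Require Import Defs.
From HB Require Import structures.
From mathcomp Require Import all_boot all_order all_algebra zify ring lra.
From mathcomp Require Import all_classical all_reals all_analysis.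
Import Order.TTheory GRing.Theory Num.Theory.
Import numFieldNormedType.Exports.
Set Implicit Arguments.
Unset Strict Implicit.
Unset Printing Implicit Defensive.

(* Let q_i = 2^(i+3) and p_n = q_0 ... q_(n-1).  The sequence mseq maps t to
   the parity of the number of maximal digits of t in the mixed radix system
   (q_i), so that its prefix B_n of length p_n satisfies
   B_(n+1) = B_n^(q_n - 1) C_n, where C_n is the complement of B_n.  Its orbit
   closure is minimal, and since the 1/q_i are summable, few blocks C_n occur
   in B_m: the frequencies of a word in the B_n converge and define an
   invariant measure mu, which is ergodic because most windows of B_m have
   almost the right frequencies.

   For y : nat -> nat let k_i = min(y_i, i) + 1.  Going up through the levels
   there is a point encode y which reads, at level i, k_i - 1 blocks B_i and
   then a block C_i.  At the end of that block the bad block C_i makes up a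
   proportion of about 1/k_i of what has been read, so encode y is generic for
   mu exactly when y tends to infinity.  The set of such y is not Sigma^0_3: if
   it were a union of G_delta sets F_i, then by Baire category in the closed set
   of the extensions of a finite word by values >= i, some longer word with new
   values >= i has no such extension in F_i; iterating over i yields a y that
   tends to infinity and lies in no F_i. *)

(** * A generalized Morse sequence *)

Lemma sum_ord_split (F : nat -> nat) n N : n <= N ->
  \sum_(i < N) F i = \sum_(i < n) F i + \sum_(i < N - n) F (n + i).
Proof. by move=> /subnKC; move: (N - n) => d <-; rewrite big_split_ord. Qed.

Lemma sum_bool_le n (P : pred 'I_n) : \sum_(j < n) P j <= n.
Proof. by rewrite (leq_trans (leq_sum _ (fun j _ => leq_b1 _)))// sum1_card card_ord. Qed.

(** * Sums of a periodic function over windows *)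

Section periodic_sums.
Variables (f : nat -> nat) (c : nat).
Hypothesis fc : forall x, f (x + c) = f x.

Lemma sum_shift_period a : \sum_(j < c) f (a + j) = \sum_(j < c) f j.
Proof.
elim: a => [//|a IH]; rewrite -IH; case: c fc => [|d] fd; first by rewrite !big_ord0.
rewrite big_ord_recr [RHS]big_ord_recl /= addnC addSnnS fd addn0; congr (_ + _).
by apply: eq_bigr => j _; rewrite /bump leq0n add1n addSnnS.
Qed.

Lemma sum_periods k a : \sum_(j < k * c) f (a + j) = k * \sum_(j < c) f j.
Proof.
elim: k a => [|k IH] a; first by rewrite !mul0n big_ord0.
rewrite mulSn big_split_ord /= sum_shift_period mulSn; congr (_ + _).
by rewrite -(IH (a + c)); apply: eq_bigr => j _; rewrite addnA.
Qed.

Lemma sum_period_le s a : 0 < c ->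
  \sum_(j < s) f (a + j) <= (s %/ c).+1 * \sum_(j < c) f j.
Proof.
move=> c0; rewrite -(sum_periods _ a).
have sc : s <= (s %/ c).+1 * c by apply/ltnW; rewrite -ltn_divLR.
by rewrite -(subnK sc) addnC big_split_ord leq_addr.
Qed.

End periodic_sums.

(** * Mixed radix digits and the blocks of the sequence *)

Definition radix i := 2 ^ (i + 3).
Definition scale n := \prod_(i < n) radix i.
(** The digit of t at level i is [t %/ scale i] modulo [radix i]; it is [radix i - 1] exactly when
    [radix i] divides the successor of that quotient. *)
Definition top_digit i t := radix i %| (t %/ scale i).+1.
(** Levels below t suffice: [t < scale t], so the higher digits vanish. *)
Definition mseq t := odd (\sum_(i < t) top_digit i t).

Lemma radix_ge8 i : 8 <= radix i.
Proof. by rewrite /radix expnD leq_pmull // expn_gt0. Qed.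

Lemma radix_gt0 i : 0 < radix i.
Proof. exact: leq_trans (radix_ge8 i). Qed.

Lemma radix_gt i : i + 2 < radix i.
Proof. by apply: leq_trans (ltn_expl _ (ltnSn 1)) _; rewrite leq_exp2l// leq_add2l. Qed.

Lemma scaleS n : scale n.+1 = scale n * radix n.
Proof. exact: big_ord_recr. Qed.

Lemma scale_gt0 n : 0 < scale n.
Proof. by rewrite prodn_gt0// => i; exact: radix_gt0. Qed.

Lemma scale_ge n : 2 ^ n <= scale n.
Proof.
elim: n => [|n IH]; first by rewrite /scale big_ord0.
by rewrite scaleS expnSr leq_mul// (leq_trans _ (radix_ge8 n)).
Qed.

Lemma scale_gtn n : n < scale n.
Proof. exact: leq_trans (ltn_expl _ _) (scale_ge n). Qed.

Lemma dvdn_scale m n : m <= n -> scale m %| scale n.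
Proof.
elim: n => [|n IH]; first by rewrite leqn0 => /eqP->.
rewrite leq_eqVlt => /predU1P[->//|mn]; rewrite scaleS.
by apply: dvdn_mulr; apply: IH.
Qed.

Lemma leq_scale m n : m <= n -> scale m <= scale n.
Proof. by move=> mn; rewrite dvdn_leq ?scale_gt0 ?dvdn_scale. Qed.

Lemma top_small i t : t < scale i -> top_digit i t = false.
Proof.
move=> ti; rewrite /top_digit divn_small// dvdn1.
by have := radix_ge8 i; case: eqP => // ->.
Qed.

Lemma top_period n i a r : i < n -> top_digit i (a * scale n + r) = top_digit i r.
Proof.
move=> /dvdn_scale/dvdnP[c ->]; rewrite scaleS /top_digit [scale i * _]mulnC !mulnA.
by rewrite divnMDl ?scale_gt0// -addnS dvdn_addr// dvdn_mull.
Qed.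

Lemma top_div n i a r : n <= i -> r < scale n ->
  top_digit i (a * scale n + r) = top_digit i (a * scale n).
Proof.
move=> /dvdn_scale/dvdnP[c ci] rn; rewrite /top_digit ci [c * _]mulnC !divnMA.
by rewrite divnMDl ?scale_gt0// (divn_small rn) addn0 mulnK ?scale_gt0.
Qed.

Lemma top_last n a r : r < scale n ->
  top_digit n (a * scale n + r) = (radix n %| a.+1).
Proof. by move=> rn; rewrite /top_digit divnMDl ?scale_gt0// divn_small// addn0. Qed.

Lemma sum_top_nat m n t : t < scale n -> n <= m ->
  \sum_(i < m) top_digit i t = \sum_(i < n) top_digit i t.
Proof.
move=> tn nm; rewrite (sum_ord_split (fun i => top_digit i _) nm) [X in _ + X]big1 ?addn0//.
move=> i _; rewrite top_small//.
by rewrite (leq_trans tn)// leq_scale// leq_addr.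
Qed.

Lemma mseq_sum n t : t < scale n -> mseq t = odd (\sum_(i < n) top_digit i t).
Proof.
move=> tn; rewrite /mseq -(sum_top_nat (scale_gtn t) (leq_maxl t n)).
by rewrite (sum_top_nat tn (leq_maxr t n)).
Qed.

(** Below level n the digits of [a * scale n + r] are those of r, from level n on those of
    [a * scale n]; so b is the parity of the maximal digits of the latter, and every aligned block
    is B_n or C_n. *)
Lemma mseq_block n a : exists b, forall r, r < scale n -> mseq (a * scale n + r) = b (+) mseq r.
Proof.
set N := a * scale n + scale n.
have nN : n <= N.
  by rewrite (leq_trans (ltnW (scale_gtn n)))// leq_addl.
exists (odd (\sum_(i < N - n) top_digit (n + i) (a * scale n))) => r rn.
rewrite (@mseq_sum N) ?(mseq_sum rn); last first.
  by rewrite (leq_trans _ (ltnW (scale_gtn N)))// ltn_add2l.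
rewrite (sum_ord_split (fun i => top_digit i _) nN) oddD addbC; congr (_ (+) _); congr odd.
  by apply: eq_bigr => i _; rewrite top_div ?leq_addr.
by apply: eq_bigr => i _; rewrite top_period.
Qed.

(** The block of level n around t shares the digits of t from level n on. None of them is maximal,
    so the block is B_n and not C_n. *)
Lemma mseq_block_id n m t r : t < scale m -> \sum_(n <= i < m) top_digit i t = 0 -> r < scale n ->
  mseq (t %/ scale n * scale n + r) = mseq r.
Proof.
move=> tm h rn.
have [mn|nm] := leqP m n.
  by rewrite divn_small ?mul0n// (leq_trans tm)// leq_scale.
have rm : t %/ scale n * scale n + r < scale m.
  have /dvdnP[c cE] := dvdn_scale (ltnW nm).
  have tc : t %/ scale n < c by rewrite ltn_divLR ?scale_gt0 -?cE.
  rewrite cE; apply: leq_trans (_ : (t %/ scale n).+1 * scale n <= _).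
    by rewrite mulSn addnC ltn_add2r.
  by rewrite leq_mul2r tc orbT.
rewrite (mseq_sum rm) (mseq_sum rn) (sum_ord_split (fun i => top_digit i _) (ltnW nm)) oddD.
rewrite [X in _ (+) odd X]big1 => [|i _].
  rewrite addbF; congr odd; apply: eq_bigr => i _; exact: congr1 (top_period _ _ (ltn_ord i)).
have := h; rewrite {1}(divn_eq t (scale n)) => /eqP.
rewrite sum_nat_seq_eq0 => /allP /(_ (n + i)); rewrite mem_index_iota leq_addr /=.
rewrite -ltn_subRL ltn_ord => /(_ isT).
by rewrite top_div ?leq_addr ?ltn_mod ?scale_gt0// top_div ?leq_addr// => /eqP.
Qed.

(** The leading digit adds exactly one maximal digit: the last subblock of B_(n+1) is C_n. *)
Lemma mseq_last n r : r < scale n -> mseq ((radix n).-1 * scale n + r) = ~~ mseq r.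
Proof.
move=> rn; have r0 := radix_gt0 n; rewrite (@mseq_sum n.+1).
  rewrite big_ord_recr /= top_last// prednK// dvdnn addn1 /= (mseq_sum rn).
  by congr (~~ odd _); apply: eq_bigr => i _; rewrite top_period.
by rewrite scaleS; nia.
Qed.

(* A block of level n.+1 is B_(n+1) or C_(n+1); the copy of B_n is at its start in
   the first case, at its end in the second. *)
Lemma mseq_recurrent n t : exists t0, [/\ t <= t0, t0 + scale n <= t + 2 * scale n.+1 &
  forall r, r < scale n -> mseq (t0 + r) = mseq r].
Proof.
set a := (t %/ scale n.+1).+1; have [b bP] := mseq_block n.+1 a.
have lea : t <= a * scale n.+1 by apply/ltnW; rewrite -ltn_divLR ?scale_gt0.
have gea : a * scale n.+1 <= t + scale n.+1 by rewrite mulSn addnC leq_add2r leq_trunc_div.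
have r0 := radix_gt0 n; have := scaleS n; case: b bP => bP sn.
- exists (a * scale n.+1 + (radix n).-1 * scale n); split; [nia|nia|move=> r rn].
  by rewrite -addnA bP ?mseq_last ?negbK//; nia.
- exists (a * scale n.+1); split; [nia|nia|move=> r rn].
  by rewrite bP//; nia.
Qed.

(** In one period the digit at level i is maximal exactly on the last of the [radix i] blocks of
    length [scale i]. *)
Lemma sum_top_scale i : \sum_(j < scale i.+1) top_digit i j = scale i.
Proof.
have := radix_gt0 i; rewrite scaleS mulnC; case: (radix i) (top_last (n := i)) => // q tl _.
rewrite mulSn addnC big_split_ord /= big1 ?add0n; last first.
  move=> j _; rewrite {1}(divn_eq j (scale i)) tl ?ltn_mod ?scale_gt0//.
  rewrite gtnNdvd// ltnS; case: j => j /= jq.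
  by rewrite ltn_divLR ?scale_gt0// (leq_trans jq).
rewrite (eq_bigr (fun=> 1)) ?sum1_card ?card_ord// => j _.
by rewrite tl ?dvdnn.
Qed.

Lemma sum_top_le i a s :
  \sum_(j < s) top_digit i (a + j) <= (s %/ scale i.+1).+1 * scale i.
Proof.
rewrite -[X in _ <= _ * X](sum_top_scale i).
apply: (sum_period_le (f := fun t => top_digit i t : nat)); last exact: scale_gt0.
by move=> x; rewrite addnC -{1}[scale i.+1]mul1n top_period.
Qed.

(** * Patterns that depend on finitely many letters *)

(** The counterpart, for times t, of a cylinder condition: P looks only at the L letters from t
    on. *)
Definition local L (P : pred nat) :=
  forall t t', (forall s, s < L -> mseq (t + s) = mseq (t' + s)) -> P t = P t'.

(* Outside the positions with a maximal digit at some level i >= m, and away from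
   the last L positions of a block of level m, P is periodic of period scale m. *)
Lemma local_window L P m n a s : local L P -> a + s <= scale n ->
  \sum_(j < s) P (a + j) <= \sum_(j < s) \sum_(m <= i < n) top_digit i (a + j) +
    (s %/ scale m).+1 * (\sum_(r < scale m) P r + L).
Proof.
move=> PL asn; set w := scale m; have w0 : 0 < w by exact: scale_gt0.
pose f t : nat := P (t %% w) + (w < t %% w + L).
have fw x : f (x + w) = f x by rewrite /f modnDr.
have ff : \sum_(j < w) f j <= \sum_(r < w) P r + L.
  rewrite big_split /= leq_add//.
    by apply: eq_leq; apply: eq_bigr => j _; rewrite modn_small.
  have [wL|Lw] := leqP w L; first exact: leq_trans (sum_bool_le _) wL.
  rewrite (sum_ord_split (fun j => w < j %% w + L) (leq_subr L w)) big1 ?add0n => [|j _].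
    by rewrite subKn ?(ltnW Lw)// (leq_trans (sum_bool_le _)).
  have := ltn_ord j; rewrite ltn_subRL => jL.
  by rewrite modn_small ?(leq_ltn_trans (leq_addl L j) jL)// ltnNge addnC (ltnW jL).
apply: leq_trans (leq_add (leqnn _) (leq_mul (leqnn _) ff)).
apply: leq_trans (leq_add (leqnn _) (sum_period_le fw s a w0)).
rewrite -big_split /= leq_sum// => j _; set t := a + j.
have tn : t < scale n by rewrite (leq_trans _ asn)// ltn_add2l.
have [h|h] := posnP (\sum_(m <= i < n) top_digit i t); last first.
  by rewrite (leq_trans (leq_b1 _))// (leq_trans h)// leq_addr.
rewrite h add0n /f; have [//|tL] := ltnP w (t %% w + L).
  by rewrite (leq_trans (leq_b1 _))// leq_addl.
rewrite addn0; apply: eq_leq; congr nat_of_bool; apply: PL => l lL.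
rewrite {1}(divn_eq t w) -addnA (mseq_block_id tn)//.
by rewrite (leq_trans _ tL)// ltn_add2l.
Qed.

Lemma geometric_tail (x : nat -> nat) s m n :
  (forall i, m <= i < n -> 2 ^ i.+1 * x i <= s) -> 2 ^ m * \sum_(m <= i < n) x i <= s.
Proof.
have [mn|/ltnW nm _] := leqP m n; last by rewrite big_geq// muln0.
rewrite -(subnKC mn); move: (n - m) => d hx.
(* The factor [(2 ^ d).-1] keeps track of the partial geometric sum; the induction needs this
   sharper form. *)
suff h : 2 ^ (m + d) * \sum_(m <= i < m + d) x i <= (2 ^ d).-1 * s.
  rewrite -(leq_pmul2r (expn_gt0 2 d)) mulnAC -expnD (leq_trans h)// mulnC leq_mul2l.
  by rewrite leq_pred orbT.
elim: d hx => [|d IH] hx; first by rewrite addn0 big_geq// muln0.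
have {}IH := IH (fun i hi => hx i ltac:(lia)).
have := hx (m + d) ltac:(lia).
rewrite addnS big_nat_recr ?leq_addr//= !expnS mulnDr.
have := expn_gt0 2 d; move: IH; rewrite !expnD /=; nia.
Qed.

(** The scales grow at least geometrically, so those selected here sum to at most twice the largest
    one. *)
Lemma sum_scale_le K m s n :
  K * \sum_(m <= i < n) (K * scale i < s) * scale i <= 2 * s.
Proof.
have geo l : \sum_(m <= i < l.+1) scale i <= 2 * scale l.
  elim: l => [|l IH].
    case: m => [|m]; [by rewrite big_nat1 leq_pmull|by rewrite big_geq].
  have [ml|ml] := leqP m l.+1; last by rewrite big_geq.
  rewrite big_nat_recr//= scaleS; have := radix_ge8 l; nia.
elim: n => [|n IH]; first by rewrite big_geq// muln0.
have [mn|nm] := leqP m n; last by rewrite big_geq ?muln0.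
have [Ks|sK] := ltnP (K * scale n) s; last first.
  by rewrite big_nat_recr//= ltnNge sK mul0n addn0.
apply: (@leq_trans (K * (2 * scale n))); last by rewrite mulnCA leq_mul2l (ltnW Ks) orbT.
rewrite leq_mul2l (leq_trans _ (geo n)) ?orbT//.
by apply: leq_sum => i _; case: (_ < s); rewrite ?mul1n.
Qed.

(** Level i has maximal digits in proportion [1 / radix i], and levels from n on have none before
    [scale n]. *)
Lemma sum_bad_prefix_le m n N :
  2 ^ m * \sum_(j < scale n) \sum_(m <= i < N) top_digit i j <= scale n.
Proof.
rewrite exchange_big /=; apply: geometric_tail => i _.
have [ni|iN] := leqP n i.
  rewrite big1 ?muln0// => j _; rewrite top_small//.
  by rewrite (leq_trans (ltn_ord j))// leq_scale.
have /dvdnP[c ->] := dvdn_scale iN.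
have per x : top_digit i (x + scale i.+1) = top_digit i x :> nat.
  by rewrite addnC -{1}[scale i.+1]mul1n top_period.
rewrite (sum_periods per c 0) sum_top_scale mulnCA leq_mul2l scaleS [2 ^ _ * _]mulnC leq_mul2l.
by rewrite leq_exp2l// -addn1 leq_add2l !orbT.
Qed.

(* At level i the starting position is followed by [gap y i] blocks B_i and then
   by one block C_i; [remaining y n] positions are left in the block of level n. *)
Definition gap (y : nat -> nat) i := minn (y i) i.
Definition digit y i := radix i - (gap y i).+2.
Definition start y n := \sum_(i < n) digit y i * scale i.
Definition remaining y n := (\sum_(i < n) (gap y i).+1 * scale i).+1.
Definition encode y s := mseq (start y s + s).

(** * Following an encoded point through the levels *)

Section encode.
Variable y : nat -> nat.

Lemma digitE i : digit y i + (gap y i).+2 = radix i.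
Proof. by rewrite subnK// /gap; have := radix_gt i; lia. Qed.

Lemma startS n : start y n.+1 = digit y n * scale n + start y n.
Proof. by rewrite /start big_ord_recr addnC. Qed.

Lemma remainingS n : remaining y n.+1 = remaining y n + (gap y n).+1 * scale n.
Proof. by rewrite /remaining big_ord_recr. Qed.

Lemma start_remaining n : start y n + remaining y n = scale n.
Proof.
elim: n => [|n IH]; first by rewrite /start /remaining /scale !big_ord0.
rewrite startS remainingS scaleS -digitE; nia.
Qed.

Lemma remaining_gt n : n < remaining y n.
Proof.
rewrite ltnS -[X in X <= _]card_ord -sum1_card.
by apply: leq_sum => i _; rewrite muln_gt0 scale_gt0.
Qed.

Lemma remaining_le n : remaining y n <= scale n.
Proof. by rewrite -(start_remaining n) leq_addl. Qed.

Lemma leq_remaining m n : m <= n -> remaining y m <= remaining y n.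
Proof.
move=> /subnKC <-; elim: (n - m) => [|d IH]; first by rewrite addn0.
by rewrite addnS remainingS (leq_trans IH)// leq_addr.
Qed.

Lemma mseq_digit n a r : a.+1 < radix n -> r < scale n -> mseq (a * scale n + r) = mseq r.
Proof.
move=> an rn; rewrite (@mseq_sum n.+1); last by rewrite scaleS; nia.
rewrite big_ord_recr /= top_last// gtnNdvd// addn0 (mseq_sum rn).
by congr odd; apply: eq_bigr => i _; rewrite top_period.
Qed.

Lemma mseq_startS n j : j < remaining y n -> mseq (start y n.+1 + j) = mseq (start y n + j).
Proof.
move=> jn; rewrite startS -addnA mseq_digit//; first by have := digitE n; lia.
by rewrite -(start_remaining n) ltn_add2l.
Qed.

Lemma mseq_start n d j : j < remaining y n -> mseq (start y (n + d) + j) = mseq (start y n + j).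
Proof.
move=> jn; elim: d => [|d IH]; first by rewrite addn0.
by rewrite addnS mseq_startS// (leq_trans jn)// leq_remaining// leq_addr.
Qed.

(** Going up one level keeps the first [remaining y n] letters, and level s already shows position s
    because [s < remaining y s]. *)
Lemma encodeE s n : s < remaining y n -> encode y s = mseq (start y n + s).
Proof.
move=> sn; rewrite /encode; have [ns|/ltnW ns] := leqP s n.
  by rewrite -(mseq_start (n - s) (remaining_gt s)) subnKC.
by rewrite -(mseq_start (s - n) sn) subnKC.
Qed.

Lemma sum_mseq_positive n k a : a + k < radix n ->
  \sum_(j < k * scale n) mseq (a * scale n + j) = k * \sum_(r < scale n) mseq r.
Proof.
elim: k a => [|k IH] a ak; first by rewrite !mul0n big_ord0.
rewrite [k.+1 * scale n]mulSn big_split_ord /= mulSn; congr (_ + _).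
  by apply: eq_bigr => j _; rewrite mseq_digit//; lia.
rewrite -(IH a.+1); last by lia.
by apply: eq_bigr => j _; rewrite /= addnA -mulSnr.
Qed.

Lemma sum_mseq_negative n : \sum_(j < scale n) mseq ((radix n).-1 * scale n + j) =
  scale n - \sum_(r < scale n) mseq r.
Proof.
rewrite (eq_bigr (fun j : 'I_(scale n) => ~~ mseq j : nat)) => [|j _]; last by rewrite mseq_last.
apply/eqP; rewrite -(eqn_add2r (\sum_(r < scale n) mseq r)) subnK ?sum_bool_le//.
rewrite -big_split /= (eq_bigr (fun=> 1)) ?sum1_card ?card_ord// => j _.
by case: (mseq j).
Qed.

Lemma sum_mseq_scaleS n : \sum_(r < scale n.+1) mseq r =
  (radix n).-1 * \sum_(r < scale n) mseq r + (scale n - \sum_(r < scale n) mseq r).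
Proof.
have -> : scale n.+1 = (radix n).-1 * scale n + scale n.
  by rewrite -mulSnr prednK ?radix_gt0// scaleS mulnC.
rewrite big_split_ord /= sum_mseq_negative; congr (_ + _).
rewrite -(@sum_mseq_positive _ _ 0) ?mul0n//; last by rewrite ltn_predL radix_gt0.
Qed.

(** Between the two times the point reads [gap y n] blocks B_n and then one block C_n. *)
Lemma sum_encodeS n : \sum_(j < remaining y n.+1) encode y j =
  \sum_(j < remaining y n) encode y j + gap y n * \sum_(r < scale n) mseq r +
  (scale n - \sum_(r < scale n) mseq r).
Proof.
have dE := digitE n; have SE := start_remaining n.
have E : remaining y n.+1 = remaining y n + gap y n * scale n + scale n.
  by rewrite remainingS mulSnr addnA.
rewrite E !big_split_ord /=; congr (_ + _ + _).
- rewrite -(@sum_mseq_positive n _ (digit y n).+1); last by lia.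
  apply: eq_bigr => j _; rewrite (@encodeE _ n.+1); last by rewrite E; have := ltn_ord j; lia.
  by rewrite startS mulSn; congr (nat_of_bool (mseq _)); lia.
- rewrite -sum_mseq_negative; apply: eq_bigr => j _.
  rewrite (@encodeE _ n.+1); last by rewrite E; have := ltn_ord j; lia.
  have -> : (radix n).-1 = (digit y n + gap y n).+1 by lia.
  by rewrite startS mulSn mulnDl; congr (nat_of_bool (mseq _)); lia.
Qed.

Lemma start_split i n : i <= n -> exists c, start y n = c * scale i + start y i.
Proof.
move=> /subnKC <-; elim: (n - i) => [|d [c cE]]; first by exists 0; rewrite addn0.
have /dvdnP[b bE] := dvdn_scale (leq_addr d i).
exists (digit y (i + d) * b + c); rewrite addnS startS cE bE; nia.
Qed.

Lemma sum_top_start n i s : i < n ->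
  \sum_(j < s) top_digit i (start y n + j) <=
  s %/ scale i.+1 * scale i + (gap y i * scale i < s) * scale i.
Proof.
move=> iN; have [//|sg] := ltnP (gap y i * scale i) s.
  by rewrite mul1n -mulSnr sum_top_le.
rewrite big1 ?leq0n// => j _; have [c ->] := start_split iN.
rewrite -addnA top_period// startS -addnA /top_digit divnMDl ?scale_gt0// gtnNdvd//.
have : (start y i + j) %/ scale i <= gap y i.
  rewrite -ltnS ltn_divLR ?scale_gt0// mulSn -addSn leq_add//; last first.
    by rewrite (leq_trans _ sg)// ltnW.
  by rewrite -(start_remaining i) -addn1 leq_add2l.
by have := digitE i; lia.
Qed.

(** A collects the contributions of full periods, which are summable over the levels; B collects at
    most one extra block C_i per level, and only where [K * scale i < s]. *)
Lemma start_bad m n s K : (forall i, m <= i -> K <= gap y i) ->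
  exists A B, [/\ \sum_(j < s) \sum_(m <= i < n) top_digit i (start y n + j) <= A + B,
    2 ^ m * A <= s & K * B <= 2 * s].
Proof.
move=> Ky; exists (\sum_(m <= i < n) s %/ scale i.+1 * scale i).
exists (\sum_(m <= i < n) (K * scale i < s) * scale i); split.
- rewrite exchange_big -big_split /= !big_nat; apply: leq_sum => i /andP[mi iN].
  apply: leq_trans (sum_top_start _ iN) _; rewrite leq_add2l leq_mul2r.
  have [gs|_] := ltnP (gap y i * scale i) s; last by rewrite orbT.
  rewrite (leq_ltn_trans _ gs) ?orbT//.
  by rewrite leq_mul2r Ky ?orbT.
- apply: geometric_tail => i _; apply: leq_trans (leq_trunc_div s (scale i.+1)).
  rewrite mulnCA leq_mul2l scaleS [2 ^ _ * _]mulnC leq_mul2l.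
  by rewrite leq_exp2l// -addn1 leq_add2l !orbT.
- exact: sum_scale_le.
Qed.

End encode.

(** * Densities of local patterns *)

Local Open Scope classical_set_scope.
Local Open Scope ring_scope.

Lemma localC L P : local L P -> local L (predC P).
Proof. by move=> PL t t' /PL /= ->. Qed.

Section densities.
Variable R : realType.
Implicit Types (P : pred nat) (L m n a s : nat).

Definition density P n : R := (\sum_(r < scale n) P r)%:R / (scale n)%:R.
(** The limit exists for local P by [density_cvg]; it will be the measure of the set that P
    describes. *)
Definition mean P : R := limn (density P).

Let scale_pos n : 0 < (scale n)%:R :> R.
Proof. by rewrite ltr0n scale_gt0. Qed.

Let exp2_pos m : 0 < 2 ^- m :> R.
Proof. by rewrite invr_gt0 exprn_gt0. Qed.

Lemma density_ge0 P n : 0 <= density P n.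
Proof. by rewrite divr_ge0. Qed.

Lemma sum_predC P a s :
  (\sum_(j < s) predC P (a + j)%N)%:R = s%:R - (\sum_(j < s) P (a + j)%N)%:R :> R.
Proof.
apply/eqP; rewrite eq_sym subr_eq -natrD -big_split /=.
rewrite (eq_bigr (fun=> 1%N)) ?sum1_card ?card_ord// => j _.
by case: (P _).
Qed.

Lemma densityC P n : density (predC P) n = 1 - density P n.
Proof. by rewrite /density (sum_predC P 0) mulrBl divff// gt_eqF. Qed.

(** [local_window] bounds counts from above; applied to the complement of P it gives the lower
    bound. *)
Lemma window_density L P m n a s : local L P -> (a + s <= scale n)%N ->
  `|(\sum_(j < s) P (a + j)%N)%:R - s%:R * density P m| <=
  (\sum_(j < s) \sum_(m <= i < n) top_digit i (a + j))%:R +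
  s%:R * L%:R * 2 ^- m + L%:R + (scale m)%:R.
Proof.
move=> PL asn; set B := (\sum_(j < s) \sum_(m <= i < n) _)%N.
have up Q : local L Q -> (\sum_(j < s) Q (a + j)%N)%:R - s%:R * density Q m <=
    B%:R + s%:R * L%:R * 2 ^- m + L%:R + (scale m)%:R.
  move=> QL; have := local_window m QL asn; rewrite -/B -(ler_nat R) natrD natrM natrD.
  set G := (\sum_(r < scale m) Q r)%:R; set S := (\sum_(j < s) _)%:R => h.
  have Gw : G <= (scale m)%:R by rewrite ler_nat sum_bool_le.
  have dE : density Q m = G / (scale m)%:R by [].
  have sw : (s %/ scale m).+1%:R <= s%:R / (scale m)%:R + 1 :> R.
    by rewrite -addn1 natrD lerD2r ler_pdivlMr// -natrM ler_nat leq_trunc_div.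
  have := ler_wpM2r (_ : 0 <= G + L%:R) sw; rewrite addr_ge0// => /(_ isT) h2.
  have wm : (scale m)%:R^-1 <= 2 ^- m :> R.
    by rewrite lef_pV2 ?posrE ?exprn_gt0// -natrX ler_nat scale_ge.
  have h3 : s%:R * L%:R / (scale m)%:R <= s%:R * L%:R * 2 ^- m :> R.
    by rewrite ler_wpM2l// mulr_ge0.
  rewrite dE; move: h2; rewrite mulrDl mul1r mulrDr; lra.
have := up _ PL; have := up _ (localC PL).
rewrite sum_predC densityC => h1 h2; rewrite ler_norml; apply/andP; split; lra.
Qed.

(** With the whole prefix of length [scale n] as window, each of the four error terms is at most 1
    or L times [2 ^- m * scale n]. *)
Lemma density_cauchy L P m n : local L P -> (m <= n)%N ->
  `|density P n - density P m| <= (2 * L%:R + 2) * 2 ^- m.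
Proof.
move=> PL; rewrite leq_eqVlt => /predU1P[->|mn].
  by rewrite subrr normr0 mulr_ge0 ?addr_ge0 ?mulr_ge0// ltW.
have := window_density m PL (leqnn (0 + scale n)).
have -> : (\sum_(j < scale n) P (0 + j)%N)%:R = (scale n)%:R * density P n.
  by rewrite mulrCA divff ?mulr1// gt_eqF.
rewrite -mulrBr normrM ger0_norm// => h.
rewrite -(ler_pM2l (scale_pos n)) (le_trans h)//.
have w2 : (scale m)%:R <= (scale n)%:R * 2 ^- m :> R.
  rewrite ler_pdivlMr ?exprn_gt0// -natrX -natrM ler_nat (leq_trans _ (leq_scale mn))//.
  by rewrite scaleS leq_mul2l leq_exp2l// leq_addr orbT.
have b2 : (\sum_(j < scale n) \sum_(m <= i < n) top_digit i j)%:R <= (scale n)%:R * 2 ^- m :> R.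
  rewrite ler_pdivlMr ?exprn_gt0// -natrX -natrM ler_nat mulnC.
  exact: sum_bad_prefix_le.
have l2 : L%:R <= L%:R * ((scale n)%:R * 2 ^- m) :> R.
  rewrite ler_peMr// ler_pdivlMr ?exprn_gt0// mul1r -natrX ler_nat.
  exact: leq_trans (scale_ge m) (leq_scale (ltnW mn)).
lra.
Qed.

Lemma exp2_cvg : (fun m => 2 ^- m : R) @ \oo --> (0 : R).
Proof. by under eq_fun do rewrite -exprVn; apply: cvg_expr; rewrite ger0_norm//; lra. Qed.

Lemma density_cvg L P : local L P -> density P @ \oo --> mean P.
Proof.
move=> PL; apply/cauchy_cvgP/cauchy_exP => e e0.
have c0 : 0 < 2 * L%:R + 2 :> R by rewrite ltr_wpDl// mulr_ge0.
have /cvgrPdist_lt/(_ _ (divr_gt0 e0 c0)) : (fun m => 2 ^- m : R) @ \oo --> (0 : R).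
  exact: exp2_cvg.
move=> [m _ /(_ m (leqnn m))]; rewrite sub0r normrN ger0_norm ?ltW// => h.
exists (density P m); exists m => // n /= mn.
rewrite /ball /= distrC (le_lt_trans (density_cauchy PL mn))//.
by rewrite mulrC -ltr_pdivlMr.
Qed.

Lemma density_mean L P m : local L P ->
  `|mean P - density P m| <= (2 * L%:R + 2) * 2 ^- m.
Proof.
move=> PL; have dc : `|density P n - density P m| @[n --> \oo] --> `|mean P - density P m|.
  by apply: cvg_norm; apply: cvgB; [exact: density_cvg PL|exact: cvg_cst].
apply: (cvgr_to_le dc); exists m => // n; exact: density_cauchy.
Qed.

Lemma exp2_small (c e : R) : 0 < e -> \forall m \near \oo, c * 2 ^- m <= e.
Proof.
move=> e0; have h : (fun m => c * 2 ^- m : R) @ \oo --> c * 0.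
  by apply: cvgM; [exact: cvg_cst|exact: exp2_cvg].
by apply: (cvgr_le _ h); rewrite mulr0.
Qed.

Lemma exp2_bound_eq0 (c x : R) : (forall m, `|x| <= c * 2 ^- m) -> x = 0.
Proof.
move=> h; apply/eqP; rewrite -normr_le0; apply/ler_addgt0Pl => e e0; rewrite addr0.
by have [m _ /(_ m (leqnn m))] := exp2_small c e0; exact: le_trans.
Qed.

Lemma mean_pred0 : mean pred0 = 0.
Proof.
apply/cvg_lim => //; have -> : density pred0 = fun=> 0; last exact: cvg_cst.
by apply/funext => n; rewrite /density big1 ?mul0r.
Qed.

Lemma meanC L P : local L P -> mean (predC P) = 1 - mean P.
Proof.
move=> PL; apply/cvg_lim => //; rewrite (funext (densityC P)).
by apply: cvgB; [exact: cvg_cst|exact: density_cvg PL].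
Qed.

Lemma mean_ge0 L P : local L P -> 0 <= mean P.
Proof. by move=> /density_cvg/cvgr_to_ge; apply; exists 0%N => // n _; exact: density_ge0. Qed.

Lemma mean_predU L P Q : local L P -> local L Q -> (forall t, ~~ (P t && Q t)) ->
  mean (predU P Q) = mean P + mean Q.
Proof.
move=> PL QL PQ; apply/cvg_lim => //.
have -> : density (predU P Q) = density P \+ density Q.
  apply/funext => n; rewrite /density /= -mulrDl -natrD -big_split /=.
  congr (_%:R / _); apply: eq_bigr => t _.
  by have /= := PQ t; case: (P t); case: (Q t).
by apply: cvgD; [exact: density_cvg PL|exact: density_cvg QL].
Qed.

Lemma local_shift L P : local L P -> local L.+1 (fun t => P t.+1).
Proof.
move=> PL t t' h; apply: PL => s sL.
by have := h s.+1 sL; rewrite !addnS !addSn.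
Qed.

(** The counts over a prefix and over its shift differ only by two boundary terms, whose proportion
    vanishes. *)
Lemma mean_shift L P : local L P -> mean (fun t => P t.+1) = mean P.
Proof.
move=> PL; apply/eqP; rewrite -subr_eq0; apply/eqP.
have SL := local_shift PL.
apply: (@exp2_bound_eq0 (2 * L%:R + 2 + (2 * L.+1%:R + 2) + 1)) => m.
have d : `|density (fun t => P t.+1) m - density P m| <= 2 ^- m.
  rewrite -mulrBl normrM [`|_^-1|]ger0_norm// ler_pdivrMr//.
  have : (\sum_(r < scale m) P r.+1 + P 0 = \sum_(r < scale m) P r + P (scale m))%N.
    transitivity (\sum_(r < (scale m).+1) P r)%N; last by rewrite big_ord_recr.
    by rewrite big_ord_recl addnC.
  move=> /(congr1 (fun n => n%:R : R)); rewrite !natrD => E.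
  have sm : 1 <= 2 ^- m * (scale m)%:R :> R.
    by rewrite mulrC ler_pdivlMr ?exprn_gt0// mul1r -natrX ler_nat scale_ge.
  have p0 : (P 0%N)%:R <= 1 :> R by rewrite lern1 leq_b1.
  have p1 : (P (scale m))%:R <= 1 :> R by rewrite lern1 leq_b1.
  have p2 := ler0n R (P 0%N); have p3 := ler0n R (P (scale m)).
  rewrite (le_trans _ sm)// ler_norml; apply/andP; split; lra.
have h1 := density_mean m PL; have h2 := density_mean m SL.
move: d h1 h2; rewrite !ler_norml => /andP[? ?] /andP[? ?] /andP[? ?].
apply/andP; split; lra.
Qed.

Lemma window_mean L P m n a s : local L P -> (a + s <= scale n)%N ->
  `|(\sum_(j < s) P (a + j)%N)%:R - s%:R * mean P| <=
  (\sum_(j < s) \sum_(m <= i < n) top_digit i (a + j))%:R +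
  s%:R * ((3 * L%:R + 2) * 2 ^- m) + (L%:R + (scale m)%:R).
Proof.
move=> PL /(window_density m PL); have := density_mean m PL.
have s0 := ler0n R s => h1 h2.
have : `|s%:R * (mean P - density P m)| <= s%:R * ((2 * L%:R + 2) * 2 ^- m).
  by rewrite normrM ger0_norm// ler_wpM2l.
move: h2; rewrite !ler_norml => /andP[? ?] /andP[? ?].
apply/andP; split; lra.
Qed.

Lemma local_deviation L P s (c : R) : local L P ->
  local (L + s) (fun t => c < (\sum_(j < s) P (t + j)%N)%:R).
Proof.
move=> PL t t' h; congr (c < _%:R); apply: eq_bigr => j _; congr nat_of_bool.
apply: PL => l lL; rewrite -!addnA; apply: h; have := ltn_ord j; lia.
Qed.

(* Markov's inequality: by window_mean, a window with a large deviation contains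
   many positions with a maximal digit at some level i >= m, and these are rare. *)
Lemma mean_deviation L P (e : R) : local L P -> 0 < e -> exists2 s, (0 < s)%N &
  mean (fun t => s%:R * (mean P + e) < (\sum_(j < s) P (t + j)%N)%:R) <= e.
Proof.
move=> PL e0; have e4 : 0 < e / 4 by rewrite divr_gt0.
(* Dividing this by the threshold e / 2 leaves e / 2. Windows that stick out of the prefix and the
   distance from density to mean get e / 4 each. *)
have e2 : 0 < e * e / 4 by rewrite divr_gt0// mulr_gt0.
near \oo => m.
have hm1 : (3 * L%:R + 2) * 2 ^- m <= e / 4 by near: m; exact: exp2_small.
have hm2 : 1 * 2 ^- m <= e * e / 4 by near: m; exact: exp2_small.
have [s s0 hs] : exists2 s, (0 < s)%N & L%:R + (scale m)%:R <= s%:R * (e / 4).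
  exists (Num.truncn ((L%:R + (scale m)%:R) / (e / 4))).+1 => //.
  by rewrite -ler_pdivrMr// ltW// truncnS_gt.
exists s => //; set D := (fun t => _).
have DL : local (L + s) D by exact: local_deviation.
near \oo => n.
have hn1 : s%:R * 2 ^- n <= e / 4 by near: n; exact: exp2_small.
have hn2 : (2 * (L + s)%:R + 2) * 2 ^- n <= e / 4 by near: n; exact: exp2_small.
have sn : (s <= scale n)%N.
  by apply: (leq_trans _ (ltnW (scale_gtn n))); near: n; exact: nbhs_infty_ge.
have sR : 0 < s%:R :> R by rewrite ltr0n.
pose bad t := (\sum_(m <= i < n) top_digit i t)%N.
have Dbad t : (t + s <= scale n)%N ->
    (D t)%:R * (s%:R * (e / 2)) <= (\sum_(j < s) bad (t + j)%N)%:R.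
  move=> /(window_mean m PL); rewrite ler_norml => /andP[_ h]; rewrite /D.
  have h3 : s%:R * ((3 * L%:R + 2) * 2 ^- m) <= s%:R * (e / 4) by rewrite ler_wpM2l.
  by case: ltP => /= h2; rewrite ?mul0r// mul1r; rewrite /bad; lra.
(* Each bad position lies in at most s windows. *)
have sumD : (\sum_(t < scale n - s) D t)%:R * (s%:R * (e / 2)) <=
    s%:R * (\sum_(t < scale n) bad t)%:R.
  rewrite natr_sum mulr_suml -natrM.
  apply: (@le_trans _ _ (\sum_(t < scale n - s) \sum_(j < s) bad (t + j))%N%:R).
    by rewrite natr_sum ler_sum// => t _; apply: Dbad; have := ltn_ord t; lia.
  rewrite exchange_big /= ler_nat -[X in (_ <= X * _)%N]card_ord -sum_nat_const.
  apply: leq_sum => j _; have js : (j <= scale n)%N := leq_trans (ltnW (ltn_ord j)) sn.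
  rewrite (sum_ord_split bad js) (leq_trans _ (leq_addl _ _))//.
  have -> : (scale n - j = (scale n - s) + (s - j))%N by have := ltn_ord j; lia.
  rewrite big_split_ord /= (leq_trans _ (leq_addr _ _))//.
  by apply/eq_leq/eq_bigr => t _; rewrite addnC.
have hb : (\sum_(t < scale n) bad t)%:R <= (scale n)%:R * (e * e / 4).
  apply: le_trans (_ : _ <= (scale n)%:R * 2 ^- m) _; last by rewrite ler_wpM2l// -[X in X <= _]mul1r.
  rewrite ler_pdivlMr ?exprn_gt0// -natrX -natrM ler_nat mulnC.
  exact: sum_bad_prefix_le.
have dD : density D n <= e / 2 + e / 4.
  rewrite ler_pdivrMr// (sum_ord_split D (leq_subr s _)) natrD subKn//.
  rewrite mulrDl lerD//.
    rewrite -(ler_pM2r (_ : 0 < s%:R * (e / 2))); last by rewrite mulr_gt0// divr_gt0.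
    apply: le_trans sumD _; rewrite mulrC [X in _ <= X](_ : _ = (scale n)%:R * (e * e / 4) * s%:R).
      by rewrite ler_wpM2r.
    by field.
  rewrite (le_trans (_ : _ <= s%:R))// ?ler_nat ?(sum_bool_le (n := s))//.
  move: hn1; rewrite ler_pdivrMr ?exprn_gt0// => /le_trans; apply.
  by rewrite ler_wpM2l ?(ltW e4)// -natrX ler_nat scale_ge.
have := density_mean n DL; rewrite ler_norml => /andP[_]; lra.
Unshelve. all: by end_near. Qed.

(** As y tends to infinity, [start_bad] applies with a large K. The errors from A, from B, from the
    locality of P and from the boundary get e / 4 each. *)
Lemma encode_generic y L P (e : R) :
  (forall K, exists N, forall n, (N <= n)%N -> (K <= y n)%N) -> local L P -> 0 < e ->
  exists S, forall s n, (S <= s)%N -> (s <= remaining y n)%N ->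
    `|(\sum_(j < s) P (start y n + j)%N)%:R - s%:R * mean P| <= s%:R * e.
Proof.
move=> yoo PL e0; have e4 : 0 < e / 4 by rewrite divr_gt0.
pose K := (Num.truncn (2 / (e / 4))).+1.
have hK : 2 <= K%:R * (e / 4) by rewrite -ler_pdivrMr// ltW// truncnS_gt.
have [N hN] := yoo K.
near \oo => m.
have hm1 : (3 * L%:R + 2) * 2 ^- m <= e / 4 by near: m; exact: exp2_small.
have hm2 : 1 * 2 ^- m <= e / 4 by near: m; exact: exp2_small.
(* Besides [m >= N] this asks for [m >= K], since [gap y i] is capped by i. *)
have mN : (maxn N K <= m)%N by near: m; exact: nbhs_infty_ge.
exists (Num.truncn ((L%:R + (scale m)%:R) / (e / 4))).+1 => s n hs sn.
have {}hs : L%:R + (scale m)%:R <= s%:R * (e / 4).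
  by rewrite -ler_pdivrMr// (le_trans (ltW (truncnS_gt _)))// ler_nat.
have [|A [B [AB hA hB]]] := @start_bad y m n s K.
  move=> i mi; rewrite /gap leq_min hN; lia.
have := @window_mean L P m n (start y n) s PL.
rewrite -(start_remaining y n) leq_add2l => /(_ sn) /le_trans; apply.
have h3 : s%:R * ((3 * L%:R + 2) * 2 ^- m) <= s%:R * (e / 4) by rewrite ler_wpM2l.
have {}hA : A%:R <= s%:R * (e / 4).
  apply: le_trans (_ : _ <= s%:R * 2 ^- m) _.
    by rewrite ler_pdivlMr ?exprn_gt0// mulrC -natrX -natrM ler_nat.
  by rewrite ler_wpM2l// -[X in X <= _]mul1r.
have {}hB : B%:R <= s%:R * (e / 4).
  have K0 : 0 < K%:R :> R by rewrite ltr0n.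
  rewrite -(ler_pM2l K0); apply: le_trans (_ : (2 * s)%:R <= _).
    by rewrite -natrM ler_nat.
  by rewrite natrM mulrCA mulrC ler_wpM2l.
move: AB; rewrite -(ler_nat R) natrD; lra.
Unshelve. all: by end_near. Qed.

(** * The frequency of ones and the failure of genericity *)

Lemma local_mseq : local 1 mseq.
Proof. by move=> t t' /(_ 0%N); rewrite !addn0; apply. Qed.

Lemma density_mseqS n : density mseq n.+1 = density mseq n + (1 - 2 * density mseq n) * 2 ^- (n + 3).
Proof.
rewrite /density sum_mseq_scaleS scaleS natrD natrB ?sum_bool_le// !natrM.
rewrite -subn1 natrB ?radix_gt0// [radix n]lock; unlock radix; rewrite natrX.
have := scale_pos n; have : (0 : R) < 2 ^+ (n + 3) by rewrite exprn_gt0.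
set a := (\sum_(r < scale n) mseq r)%:R; set w := (scale n)%:R; set q := 2 ^+ (n + 3).
by move=> q0 w0; field; rewrite !gt_eqF.
Qed.

(** Hence C_n has density of ones at least 3 / 4, far from the mean. *)
Lemma density_mseq_le n : density mseq n <= 1 / 4.
Proof.
(* The increments are at most [2 ^- (n + 3)] and these sum to 1 / 4; the subtracted term is their
   tail from n on. *)
suff : density mseq n <= 1 / 4 - 2 ^- n / 4 by have := exp2_pos n; lra.
elim: n => [|n IH].
  rewrite /density (_ : (\sum_(r < scale 0) mseq r = 0)%N) ?mul0r ?expr0 ?invr1; first lra.
  by rewrite /scale big_ord0 big_ord1 /mseq big_ord0.
have E : 2 ^- (n + 3) = 2 ^- n / 8 :> R by rewrite exprD invfM; congr (_ / _); ring.
rewrite density_mseqS E exprSr invfM.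
have := density_ge0 mseq n; have := exp2_pos n; set d := density mseq n; set x := 2 ^- n => x0 d0.
have : d * x >= 0 by rewrite mulr_ge0// ltW.
rewrite -/d -/x in IH *; lra.
Qed.

(** If [y n < K] for a large n, the block C_n fills a fixed proportion of the prefix of length
    [remaining y n.+1], so the averages at times [remaining y n] and [remaining y n.+1] cannot both
    be close to the mean. *)
Lemma encode_nongeneric y :
  (fun s => (\sum_(j < s) encode y j)%:R / s%:R) @ \oo --> mean mseq ->
  forall K, exists N, forall n, (N <= n)%N -> (K <= y n)%N.
Proof.
(* With [w = scale n], the excess of ones in C_n over the mean is at least w / 2, which is
   [w * e * (2 * K + 4)]; all errors together are at most [w * e * (2 * K + 1)]. *)
move=> yc K; pose e : R := (4 * K%:R + 8)^-1.
have e0 : 0 < e by rewrite invr_gt0 ltr_wpDl// mulr_ge0.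
have eK : e * (4 * K%:R + 8) = 1 by rewrite mulVf// gt_eqF// -invr_gt0.
have /cvgrPdist_le/(_ _ e0)[N1 _ h1] := yc.
have /cvgrPdist_le/(_ _ e0)[N2 _ h2] := density_cvg local_mseq.
have M4 : mean mseq <= 1 / 4.
  by apply: (cvgr_to_le (density_cvg local_mseq)); exists 0%N => // n _; exact: density_mseq_le.
exists (maxn N1 N2) => n; rewrite geq_max => /andP[n1 n2].
apply: contraT; rewrite -ltnNge => yK.
have gK : (gap y n)%:R + 1 <= K%:R :> R.
  by rewrite natr1 ler_nat (leq_ltn_trans (geq_minl _ _)).
have hX k : (n <= k)%N -> `|(\sum_(j < remaining y k) encode y j)%:R - (remaining y k)%:R * mean mseq|
    <= (remaining y k)%:R * e.
  move=> nk; have r0 : 0 < (remaining y k)%:R :> R by rewrite ltr0n.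
  have := h1 (remaining y k) (leq_trans n1 (leq_trans nk (ltnW (remaining_gt y k)))).
  rewrite -(ler_pM2l r0) => /(le_trans _); apply.
  set X := _%:R; rewrite [X - _](_ : _ = - ((remaining y k)%:R * (mean mseq - X / (remaining y k)%:R))).
    by rewrite normrN normrM ger0_norm ?(ltW r0).
  by field; rewrite gt_eqF.
have := hX n.+1 (leqnSn n); have := hX n (leqnn n).
rewrite sum_encodeS remainingS !natrD !natrM natrB ?sum_bool_le//.
have := h2 n n2; have -> : (\sum_(r < scale n) mseq r)%:R = density mseq n * (scale n)%:R.
  by rewrite divfK// gt_eqF.
have rw : (remaining y n)%:R <= (scale n)%:R :> R by rewrite ler_nat remaining_le.
have := density_mseq_le n; have := scale_pos n; have := ler0n R (gap y n).
move: rw M4 gK; set w := (scale n)%:R; set a := density mseq n; set g := (gap y n)%:R.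
set r := (remaining y n)%:R; set X := (\sum_(j < remaining y n) encode y j)%:R.
set M := mean mseq => rw M4 gK g0 w0 a4.
rewrite !ler_norml => /andP[Ma1 Ma2] /andP[X1 X2] /andP[Y1 Y2].
have r1 : r * e <= w * e by rewrite ler_pM2r.
have ga : g * w * M - g * w * a <= g * w * e by rewrite -mulrBr ler_wpM2l// mulr_ge0// ltW.
have am : w * (1 / 2) <= w * (1 - a - M) by rewrite ler_pM2l//; lra.
have ge : w * ((g + 1) * e) <= w * (K%:R * e) by rewrite ler_pM2l// ler_pM2r.
have we : 0 < w * e by rewrite mulr_gt0.
have wK : w * (e * (4 * K%:R + 8)) = w by rewrite eK mulr1.
suff : w <= 0 by rewrite leNgt w0.
lra.
Qed.

End densities.

(** * Topology of one-sided subshifts *)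

Definition agree (A : Type) n (x y : nat -> A) := forall i, (i < n)%N -> x i = y i.

Lemma agreeW (A : Type) m n (x y : nat -> A) : (m <= n)%N -> agree n x y -> agree m x y.
Proof. by move=> mn xy i im; apply: xy; exact: leq_trans mn. Qed.

(** Convergence is coordinatewise, so the filter of cylinders around x converges to x; conversely a
    cylinder is a finite intersection of coordinate conditions. *)
Lemma nbhs_full_shift (A : finType) (x : full_shift A) (U : set (full_shift A)) :
  nbhs x U <-> exists n, [set y | agree n x y] `<=` U.
Proof.
split=> [xU|[n nU]].
  pose F := filter_from [set: nat] (fun n => [set y : full_shift A | agree n x y]).
  have FF : Filter F.
    apply: filter_from_filter; first by exists 0%N.
    move=> i j _ _; exists (maxn i j) => // y xy.
    by split; apply: agreeW xy; rewrite ?leq_maxl ?leq_maxr.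
  have Fx : F --> x.
    apply/(pointwise_cvgP (V := discrete_topology A) x FF) => t.
    apply/discrete_cvg; exists t.+1 => // y xy /=; by rewrite xy.
  by have [n _ nU] := Fx _ xU; exists n.
apply: filterS nU _; elim: n => [|n IH]; first by apply: filterS filterT => y _ [].
apply: filterS (filterI IH _); last first.
  by apply: (@proj_continuous _ (fun=> discrete_topology A) n x); exact: discrete_set1.
move=> y /= [xy yn] i; rewrite ltnS leq_eqVlt => /predU1P[->|]; [exact/esym|exact: xy].
Qed.

Lemma compact_full_shift (A : finType) : compact [set: full_shift A].
Proof.
have := @tychonoff nat (fun=> discrete_topology A) (fun=> setT).
have -> : [set f : nat -> A | forall i, [set: discrete_topology A] (f i)] = setT.
  by apply/seteqP; split=> // f _ i.
apply=> i; apply: finite_compact; exact: (@finite_finset A).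
Qed.

Section subshift_topology.
Variables (A : finType) (X : subshift A).
Local Notation val := (@set_val _ (subshift_set X)).

Lemma nbhs_subshift (x : X) (U : set X) :
  nbhs x U <-> exists n, [set y : X | agree n (val x) (val y)] `<=` U.
Proof.
split=> [|[n nU]].
  move=> [_ [[W oW <-] /= Wx WU]].
  have /nbhs_full_shift[n nW] : nbhs (val x) W by exact: open_nbhs_nbhs.
  by exists n => y xy; apply: WU; exact: nW.
apply: filterS nU _; apply: (@initial_continuous X (full_shift A) val x).
by apply/nbhs_full_shift; exists n.
Qed.

(** Compactness in near-covering form, with m going to infinity: thresholds that work near each
    point merge into a global one. *)
Lemma subshift_compact_near (P : nat -> X -> Prop) :
  (forall x : X, exists n, forall (y : X) m, (n <= m)%N ->
    agree n (val x) (val y) -> P m y) ->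
  exists n, forall m (y : X), (n <= m)%N -> P m y.
Proof.
move=> hP; have : compact (subshift_set X).
  exact: (subclosed_compact (@subshift_closed _ X) (@compact_full_shift A)).
move/compact_near_coveringP => /(_ nat \oo
  (fun m y => forall yX : y \in subshift_set X, P m (exist _ y yX)) _).
case=> [x Xx|n _ h].
  have [n hn] := hP (exist _ x (mem_set Xx)).
  exists ([set y | agree n x y], [set m | (n <= m)%N]) => /=.
    by split; [apply/nbhs_full_shift; exists n|exists n].
  by move=> [y m] /= [xy nm] yX; apply: hn.
exists n => m [y yX] nm; exact: h m nm y (set_mem yX) yX.
Qed.

Lemma open_subshiftP (U : set X) : open U <->
  forall x, U x -> exists n, [set y : X | agree n (val x) (val y)] `<=` U.
Proof.
by rewrite openE; split=> h x Ux; [apply/nbhs_subshift; exact: h|apply/nbhs_subshift; exact: h].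
Qed.

(** These are the unions of cylinders of length n; one implication is enough because [agree] is
    symmetric. *)
Definition cylindrical n (U : set X) :=
  forall x y : X, agree n (val x) (val y) -> U x -> U y.

Lemma cylindricalW m n U : (m <= n)%N -> cylindrical m U -> cylindrical n U.
Proof. by move=> mn Um x y /(agreeW mn); exact: Um. Qed.

Lemma cylindricalC n U : cylindrical n U -> cylindrical n (~` U).
Proof.
move=> Un x y xy nUx Uy; apply: nUx; apply: Un Uy.
by move=> i /xy.
Qed.

Lemma cylindricalI n U V : cylindrical n U -> cylindrical n V -> cylindrical n (U `&` V).
Proof. by move=> Un Vn x y xy [Ux Vx]; split; [exact: Un Ux|exact: Vn Vx]. Qed.

Lemma cylindricalU n U V : cylindrical n U -> cylindrical n V -> cylindrical n (U `|` V).
Proof. by move=> Un Vn x y xy [Ux|Vx]; [left; exact: Un Ux|right; exact: Vn Vx]. Qed.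

Lemma cylindrical_open n U : cylindrical n U -> open U.
Proof. by move=> Un; apply/open_subshiftP => x Ux; exists n => y xy; exact: Un Ux. Qed.

Lemma val_subshift_map (x : X) : val (subshift_map x) = Defs.shift (val x).
Proof. by []. Qed.

Lemma val_iter_map k (x : X) i : val (iter k (@subshift_map _ X) x) i = val x (k + i)%N.
Proof.
elim: k i => [//|k IH] i; rewrite iterS val_subshift_map /Defs.shift IH.
by rewrite addnS addSn.
Qed.

Lemma cylindrical_shift n U : cylindrical n U ->
  cylindrical n.+1 (@subshift_map _ X @^-1` U).
Proof.
by move=> Un x y xy; apply: Un => i iN; rewrite !val_subshift_map /Defs.shift xy.
Qed.

Lemma open_bigcup_cylindrical (U : set X) : open U ->
  exists2 F : (set X)^nat, (forall n, cylindrical n (F n)) & U = \bigcup_n F n.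
Proof.
move=> /open_subshiftP oU.
exists (fun n => [set x | [set y : X | agree n (val x) (val y)] `<=` U]).
  by move=> n x y xy xU z yz; apply: xU => i iN /=; rewrite xy// yz.
by apply/seteqP; split=> [x /oU[n nU]|x [n _ xU]]; [exists n|apply: xU].
Qed.

End subshift_topology.

(** * Diagonalization against Sigma^0_3 sets *)

Section fusion.
Implicit Types (y z w : nat -> nat) (s t : (nat -> nat) * nat).

(** A pair (y, k) codes the finite word of the first k values of y. *)
Definition extends t s := (s.2 < t.2)%N /\ agree s.2 s.1 t.1.

Lemma extends_trans r s t : extends s r -> extends t s -> extends t r.
Proof.
move=> [rs ars] [st ast]; split; first exact: ltn_trans st.
by move=> i ir; rewrite ars// ast// (ltn_trans ir).
Qed.

(** Dependent choice along growing words: V is the invariant, [P j] the task of step j, y the common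
    limit. *)
Lemma fusion (P : nat -> (nat -> nat) * nat -> (nat -> nat) * nat -> Prop)
    (V : (nat -> nat) * nat -> Prop) s0 :
  V s0 -> (forall j s, V s -> exists t, [/\ V t, extends t s & P j s t]) ->
  exists (S : nat -> (nat -> nat) * nat) y,
    [/\ forall j, (j <= (S j).2)%N, forall j, P j (S j) (S j.+1) &
        forall j, agree (S j).2 (S j).1 y].
Proof.
move=> Vs0 hV.
have /choice[f fP] (js : nat * ((nat -> nat) * nat)) :
    exists t, V js.2 -> [/\ V t, extends t js.2 & P js.1 js.2 t].
  case: js => j s /=; have [Vs|nVs] := pselect (V s); last by exists s => /nVs.
  by have [t ht] := hV j s Vs; exists t.
pose fix S j := if j is k.+1 then f (k, S k) else s0.
have VS j : V (S j) by elim: j => //= j /(fP (j, S j))[].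
have ext j : extends (S j.+1) (S j) by have [] := fP (j, S j) (VS j).
have PS j : P j (S j) (S j.+1) by have [] := fP (j, S j) (VS j).
have ext2 j k : (j < k)%N -> extends (S k) (S j).
  elim: k => // k IH; rewrite ltnS leq_eqVlt => /predU1P[->//|/IH h].
  exact: extends_trans (ext k).
have gtS j : (j <= (S j).2)%N.
  by elim: j => // j IH; have [h _] := ext j; exact: leq_ltn_trans h.
(* [S i.+1] has length at least i + 1, so it determines the value at i. *)
exists S, (fun i => (S i.+1).1 i); split=> // j i ij.
have [h|h|->//] := ltngtP j i.+1.
  by have [_] := ext2 _ _ h; exact.
by have [_ /(_ i)<-//] := ext2 _ _ h; exact: gtS.
Qed.

(** [phi] reduces the set of sequences tending to infinity to G. The fusion inside [step] is the
    Baire category argument; the later one chains the words it yields. *)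
Lemma not_Sigma03_of_reduction (T : topologicalType) (G : set T) (phi : (nat -> nat) -> T) :
  (forall y U, open U -> U (phi y) -> exists n, forall z, agree n y z -> U (phi z)) ->
  (forall y, G (phi y) <-> forall K, exists N, forall n, (N <= n)%N -> (K <= y n)%N) ->
  ~ Sigma0 3 G.
Proof.
move=> phiC phiG [F hF GF].
have step i s : exists t, extends t s /\
    (forall n, (s.2 <= n < t.2)%N -> (i <= t.1 n)%N) /\
    (forall z, agree t.2 t.1 z -> (forall n, (t.2 <= n)%N -> (i <= z n)%N) -> ~ F i (phi z)).
  apply: contrapT => /forallNP noext.
  (* F i is the intersection of the open complements of the H j. *)
  have [H oH FH] := hF i.
  have FiP x : F i x <-> forall j, ~ H j x.
    split=> [Fx j Hx|hx]; last by apply: contrapT => nFx; have : (~` F i) x by []; rewrite FH => -[j _ /hx].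
    by have : (~` F i) x by rewrite FH; exists j.
  pose V t := extends t s /\ forall n, (s.2 <= n < t.2)%N -> (i <= t.1 n)%N.
  pose s1 := (fun n => if (n < s.2)%N then s.1 n else i, s.2.+1).
  have V1 : V s1.
    split; first by split=> // n /= ns; rewrite ns.
    by move=> n /= /andP[sn _]; rewrite ltnNge sn.
  (* Each step writes the value i once more and forces [phi] out of H j. The limit is then mapped
     into F i, hence into G, although it takes the value i infinitely often. *)
  pose P j (t t' : (nat -> nat) * nat) :=
    (exists2 n, (t.2 <= n < t'.2)%N & t'.1 n = i) /\
    (forall w, agree t'.2 t'.1 w -> ~ H j (phi w)).
  have [|S [y [gtS PS Sy]]] := @fusion P V _ V1.
    move=> j t [st it].
    have /existsNP[z] : ~ forall z, agree t.2 t.1 z ->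
        (forall n, (t.2 <= n)%N -> (i <= z n)%N) -> ~ F i (phi z).
      by move=> h; apply: (noext t).
    move=> /not_implyP[tz /not_implyP[iz /contrapT /FiP/(_ j) Hz]].
    have [n hn] := phiC z _ (oH j) Hz.
    (* Position N lies beyond the n values that keep [phi] outside H j, so its value may be replaced
       by i. *)
    set N := maxn n t.2.
    have tN : (t.2 <= N)%N by exact: leq_maxr.
    have ez k : (k < N)%N -> (if k == N then i else z k) = z k by move=> kN; rewrite ltn_eqF.
    have tt : extends (fun k => if k == N then i else z k, N.+1) t.
      by split=> //= k kt; rewrite ez ?tz// (leq_trans kt).
    exists (fun k => if k == N then i else z k, N.+1); split=> //.
    - split; first exact: extends_trans tt.
      move=> k /= /andP[sk kN]; case: eqP => // _.
      have [kt|/iz//] := ltnP k t.2; rewrite -tz// it// sk kt//.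
    - split; first by exists N; rewrite /= ?eqxx// tN leqnn.
      move=> w /= hw; apply: hn => k kn; rewrite -hw ?ez// ?ltnS ?leq_max ?kn ?(ltnW kn)//.
  have : G (phi y).
    by rewrite GF; exists i => //; apply/FiP => j; have [_] := PS j; apply.
  move=> /phiG/(_ i.+1)[N hN].
  have [[n /andP[n1 n2] ni] _] := PS N.
  have := hN n (leq_trans (gtS N) n1).
  by rewrite -(Sy N.+1)// ni ltnn.
pose Q i (s t : (nat -> nat) * nat) :=
  (forall n, (s.2 <= n < t.2)%N -> (i <= t.1 n)%N) /\
  (forall z, agree t.2 t.1 z -> (forall n, (t.2 <= n)%N -> (i <= z n)%N) -> ~ F i (phi z)).
have [|S [y [gtS QS Sy]]] := @fusion Q setT (fun=> 0%N, 0%N) I.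
  by move=> i s _; have [t [? [? ?]]] := step i s; exists t.
(* Stage i and the later ones only add values at least i, so y tends to infinity and its tail is
   admissible at each stage. *)
have ybig i n : ((S i).2 <= n)%N -> (i <= y n)%N.
  move=> Sn; suff h d : (n < (S (i + d)%N).2)%N -> (i <= y n)%N.
    by apply: (h n.+1); rewrite (leq_trans _ (gtS _))// addnS ltnS leq_addl.
  elim: d => [|d IH]; first by rewrite addn0 ltnNge Sn.
  have [/IH//|dn nd] := ltnP n (S (i + d)%N).2.
  rewrite -(Sy (i + d.+1)%N)//; have [h _] := QS (i + d)%N.
  by rewrite addnS (leq_trans (leq_addr d i))// h// dn -addnS.
have : G (phi y) by apply/phiG => K; exists (S K).2 => n; exact: ybig.
rewrite GF => -[i _]; have [_] := QS i; apply; first exact: Sy.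
by move=> n /ybig; exact: ltnW.
Qed.

End fusion.

(** * Borel measures on a subshift *)

Section borel.
Variables (A : finType) (X : subshift A).

Lemma open_borel (U : set X) : open U -> measurable (U : set (borel X)).
Proof. exact: sub_sigma_algebra. Qed.

Lemma cylindrical_borel n (U : set X) : cylindrical n U -> measurable (U : set (borel X)).
Proof. by move=> /cylindrical_open; exact: open_borel. Qed.

Lemma borel_cylindrical :
  (@measurable _ (borel X)) = <<s [set U : set X | exists n, cylindrical n U] >>.
Proof.
apply/seteqP; split; apply: smallest_sub.
- exact: smallest_sigma_algebra.
- move=> U /open_bigcup_cylindrical[F hF ->].
  apply: sigma_algebra_bigcup => i; apply: sub_sigma_algebra; exists i; exact: hF.
- exact: sigma_algebra_measurable.
- by move=> U [n /cylindrical_borel].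
Qed.

Lemma subshift_map_measurable : measurable_fun [set: borel X] (@subshift_map _ X : borel X -> borel X).
Proof.
apply: (@measurability _ _ (borel X) (borel X) setT (@subshift_map _ X)
  [set U : set X | exists n, cylindrical n U]); first exact: borel_cylindrical.
move=> _ [U [n Un] <-]; rewrite setTI.
exact: cylindrical_borel (cylindrical_shift Un).
Qed.

(** The cylindrical sets are closed under intersection and generate the Borel sets. *)
Lemma eq_borel_measure (R : realType) (m1 m2 : {measure set (borel X) -> \bar R}) :
  (m1 setT < +oo)%E -> (forall n U, cylindrical n U -> m1 U = m2 U) ->
  forall B, measurable B -> m1 B = m2 B.
Proof.
move=> m1T m12; apply: (@measure_unique _ R (borel X) [set U : set X | exists n, cylindrical n U] (fun=> setT)).
- exact: borel_cylindrical.
- move=> U V [m Um] [n Vn]; exists (maxn m n).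
  by apply: cylindricalI; [apply: cylindricalW Um; exact: leq_maxl|
                           apply: cylindricalW Vn; exact: leq_maxr].
- by move=> _; exists 0%N.
- by apply/seteqP; split=> // x _; exists 0%N.
- by move=> U [n]; exact: m12.
- by [].
Qed.

End borel.

(** * From finitely additive functions on cylindrical sets to Borel measures *)

(** A copy of X to carry the algebra of cylindrical sets, kept apart from the sigma-algebra of
    [borel X]. *)
Definition cylinder_algebra (A : finType) (X : subshift A) : Type := X.

Section cylinder_algebra.
Variables (A : finType) (X : subshift A).
Notation T := (cylinder_algebra X).
Let M := [set U : set T | exists n, @cylindrical A X n U].

HB.instance Definition _ := Pointed.copy T X.

Let M0 : M set0.
Proof. by exists 0%N. Qed.

Let MU : setU_closed M.
Proof.
move=> U V [m Um] [n Vn]; exists (maxn m n).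
by apply: cylindricalU; [apply: cylindricalW Um; exact: leq_maxl|
                         apply: cylindricalW Vn; exact: leq_maxr].
Qed.

Let MC : setC_closed M.
Proof. by move=> U [n Un]; exists n; exact: cylindricalC. Qed.

HB.instance Definition _ := @isAlgebraOfSets.Build default_measure_display T M M0 MU MC.

(** A cylindrical set is clopen, hence compact, so only finitely many of the disjoint pieces are
    nonempty. Finite additivity thus already gives sigma-additivity on the algebra. *)
Lemma cylindrical_trivIset_finite (F : (set X)^nat) n : (forall i, exists m, cylindrical m (F i)) ->
  cylindrical n (\bigcup_i F i) -> trivIset setT F -> exists N, forall i, (N <= i)%N -> F i = set0.
Proof.
move=> cF cU tF.
have [x|N hN] := @subshift_compact_near A X
    (fun m x => (\bigcup_i F i) x -> exists2 i, (i < m)%N & F i x).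
  have [[i _ Fix]|nU] := pselect ((\bigcup_i F i) x).
    have [m Fm] := cF i; exists (maxn m i.+1) => y k mk xy _; exists i.
      by rewrite (leq_trans _ mk)// leq_maxr.
    by apply: Fm Fix; apply: agreeW xy; exact: leq_maxl.
  exists n => y k _ xy Uy; exfalso; apply: nU; apply: cU Uy.
  by move=> i /xy.
exists N => i Ni; apply/seteqP; split=> // x Fx.
have [|j jN Fj] := hN N x (leqnn N); first by exists i.
suff ij : i = j by move: Ni; rewrite ij leqNgt jN.
by apply: tF => //; exists x.
Qed.

End cylinder_algebra.

Section cylinder_extension.
Variables (A : finType) (X : subshift A) (R : realType) (m : set X -> R).
Hypothesis m_ge0 : forall U, 0 <= m U.
Hypothesis mT : m setT = 1.
Hypothesis mU : forall n U V, cylindrical n U -> cylindrical n V -> U `&` V = set0 ->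
  m (U `|` V) = m U + m V.
Notation T := (cylinder_algebra X).

Let m0 : m set0 = 0.
Proof.
have := @mU 0 set0 set0; rewrite setU0 setI0 => h.
have h1 : m set0 = m set0 + m set0 by apply: h.
lra.
Qed.

Let mu (U : set T) : \bar R := (m U)%:E.

Let mu0 : mu set0 = 0%E. Proof. by rewrite /mu m0. Qed.

Let mu_ge0 U : (0 <= mu U)%E. Proof. by rewrite lee_fin m_ge0. Qed.

Let mu_sigma : semi_sigma_additive mu.
Proof.
move=> F mF tF [n cU].
have [N FN] := cylindrical_trivIset_finite mF cU tF.
have fin k : exists l, cylindrical l (\bigcup_(i < k) F i) /\
    (\sum_(0 <= i < k) mu (F i))%E = mu (\bigcup_(i < k) F i).
  elim: k => [|k [l [cl IH]]].
    by exists 0%N; rewrite bigcup_mkord big_ord0 big_geq// mu0; split.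
  have [l' cl'] := mF k; exists (maxn l l').
  have {}cl := cylindricalW (leq_maxl l l') cl; have {}cl' := cylindricalW (leq_maxr l l') cl'.
  rewrite bigcup_mkord big_ord_recr -bigcup_mkord /=.
  split; first exact: cylindricalU.
  rewrite big_nat_recr//= IH /mu -EFinD; congr _%:E; apply/esym; apply: mU cl cl' _.
  rewrite setI_bigcupl; apply/seteqP; split=> // x [i /= ik [Fi Fk]].
  have ik' : i = k by apply: tF => //; exists x.
  by move: ik; rewrite ik' ltnn.
apply: cvg_near_cst; exists N => // k /= Nk.
have [l [_ ->]] := fin k; suff -> : \bigcup_(i < k) F i = \bigcup_i F i by apply/eqP.
apply/seteqP; split=> x [i]; first by exists i.
move=> _ Fx; exists i => //=; have [//|ki] := ltnP i k.
by move: Fx; rewrite FN// (leq_trans Nk).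
Qed.

HB.instance Definition _ := isMeasure.Build _ T R mu mu0 mu_ge0 mu_sigma.

Let ext := measure_extension mu.

(** The Caratheodory extension lives on the sigma-algebra generated by the cylindrical sets;
    [borel_cylindrical] carries it over to the Borel sets. *)
Let nu (B : set (borel X)) : \bar R := ext B.

Let nu0 : nu set0 = 0%E. Proof. exact: measure0. Qed.

Let nu_ge0 B : (0 <= nu B)%E. Proof. exact: measure_ge0. Qed.

Let nu_sigma : semi_sigma_additive nu.
Proof.
have borelE B : measurable (B : set (borel X)) -> <<s @measurable _ T >> B.
  by move=> mB; have : (@measurable _ (borel X)) B by []; rewrite borel_cylindrical.
move=> F mF tF mUF; apply: (@measure_semi_sigma_additive _ _ _ ext) => // [i|]; exact: borelE.
Qed.

HB.instance Definition _ := isMeasure.Build _ (borel X) R nu nu0 nu_ge0 nu_sigma.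

Let nuE n U : cylindrical n U -> nu U = (m U)%:E.
Proof. by move=> Un; rewrite /nu /ext /measure_extension measurable_mu_extE//; exists n. Qed.

Let nuT : nu setT = 1%E.
Proof. by rewrite (@nuE 0)// mT. Qed.

HB.instance Definition _ := Measure_isProbability.Build _ _ _ nu nuT.

Lemma cylinder_extension : exists mu : probability (borel X) R,
  forall n U, cylindrical n U -> mu U = (m U)%:E.
Proof. by exists nu. Qed.

End cylinder_extension.

(** * Generic points and frequencies of words *)

Section generic_points.
Variables (A : finType) (X : subshift A) (R : realType).
Local Notation val := (@set_val _ (subshift_set X)).
Local Notation T := (@subshift_map _ X).
Implicit Types (nu : {measure set (borel X) -> \bar R}) (x y : X) (f g : X -> R).

Definition frequency x (U : set X) k : R := k%:R^-1 * (\sum_(j < k) (iter j T x \in U))%:R.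

Lemma empiricalE x k (U : set X) : empirical R x k U = (frequency x U k)%:E.
Proof.
transitivity ((k%:R^-1)%:E * \sum_(j < k) (\d_(iter j T x : borel X) : set _ -> \bar R) U)%E => //.
rewrite (eq_bigr (fun j : 'I_k => ((iter j T x \in U)%:R : R)%:E)) => [|j _]; last by rewrite diracE.
by rewrite sumEFin -EFinM /frequency natr_sum.
Qed.

Lemma frequencyT x k : (0 < k)%N -> frequency x setT k = 1.
Proof.
move=> k0; rewrite /frequency (eq_bigr (fun=> 1%N)) => [|j _]; last by rewrite in_setT.
by rewrite sum1_card card_ord mulVf// pnatr_eq0 -lt0n.
Qed.

Lemma continuous_subshift f x (e : R) : continuous f -> 0 < e ->
  exists n, forall y, agree n (val x) (val y) -> `|f x - f y| <= e.
Proof.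
move=> fc e0; have /cvgrPdist_le/(_ _ e0)/nbhs_subshift[n h] := fc x.
by exists n => y /h.
Qed.

Lemma uniformly_continuous_subshift f (e : R) : continuous f -> 0 < e ->
  exists n, forall x y, agree n (val x) (val y) -> `|f x - f y| <= e.
Proof.
move=> fc e0; have e2 : 0 < e / 2 by rewrite divr_gt0.
have [x|n hn] := @subshift_compact_near A X
    (fun m x => forall y, agree m (val x) (val y) -> `|f x - f y| <= e).
  have [n hn] := continuous_subshift x fc e2; exists n => y m nm xy z yz.
  have xz : agree n (val x) (val z) by move=> i iN; rewrite xy// (agreeW nm yz).
  rewrite (le_trans (ler_distD (f x) _ _))// [e]splitr.
  by apply: lerD; [rewrite distrC|]; exact: hn.
by exists n => x y xy; exact: hn (leqnn n) _ xy.
Qed.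

Lemma continuous_bounded f : continuous f -> exists M : R, forall x, `|f x| <= M.
Proof.
move=> fc; have [x|n hn] := @subshift_compact_near A X (fun m x => `|f x| <= m%:R).
  have [n hn] := continuous_subshift x fc ltr01.
  exists (maxn n (Num.truncn (`|f x| + 1)).+1) => y m; rewrite geq_max => /andP[nm Mm] xy.
  have := hn y (agreeW (leq_maxl _ _) xy); rewrite distrC => h.
  rewrite -[f y](subrK (f x)) (le_trans (ler_normD _ _))//.
  rewrite (@le_trans _ _ (`|f x| + 1))// ?[_ + `|f x|]addrC ?lerD2l//.
  by rewrite (le_trans (ltW (truncnS_gt _)))// ler_nat.
by exists n%:R => x; exact: hn.
Qed.

Lemma continuous_integrable nu f : (nu setT < +oo)%E -> continuous f ->
  nu.-integrable setT (EFin \o f).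
Proof.
move=> nuT fc; have [M fM] := continuous_bounded fc.
apply: (@measurable_bounded_integrable _ (borel X)) => //.
  apply: (@measurability _ _ (borel X) R setT f _ (measurable_realfun.RGenOpens.measurableE R)).
  move=> _ [_ [a [b ->]] <-]; rewrite setTI; apply: open_borel.
  by apply: open_comp; [move=> y _; exact: fc|exact: interval_open].
exists M; split; first exact: num_real.
by move=> M' MM' x _ /=; rewrite (le_trans (fM x))// ltW.
Qed.

Lemma indic_cylindrical_continuous n U : cylindrical n U -> continuous (\1_U : X -> R).
Proof.
move=> Un x V /nbhs_singleton Vx; apply/nbhs_subshift; exists n => y xy /=.
suff -> : \1_U y = \1_U x :> R by [].
rewrite !indicE; congr (_%:R); congr nat_of_bool; apply/idP/idP => /set_mem yU; apply/mem_set.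
  by apply: Un yU => i /xy.
exact: Un yU.
Qed.

Section words.
Variable n : nat.
Definition word x : {ffun 'I_n -> A} := [ffun i : 'I_n => val x i].
Definition word_cylinder w := [set x | word x = w].

Lemma word_cylindrical w : cylindrical n (word_cylinder w).
Proof. by move=> x y xy <-; apply/ffunP => i; rewrite !ffunE xy. Qed.

Lemma agree_word x y : word x = word y -> agree n (val x) (val y).
Proof. by move=> /ffunP xy i iN; have := xy (Ordinal iN); rewrite !ffunE. Qed.

Lemma integral_word nu (c : {ffun 'I_n -> A} -> R) : (nu setT < +oo)%E ->
  nu.-integrable setT (fun x => (c (word x))%:E) /\
  (\int[nu]_x (c (word x))%:E = \sum_w (c w)%:E * nu (word_cylinder w))%E.
Proof.
move=> nuT.
have mw w : measurable (word_cylinder w : set (borel X)).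
  exact: cylindrical_borel (@word_cylindrical w).
have E x : ((c (word x))%:E = \sum_w (c w)%:E * (\1_(word_cylinder w) x)%:E)%E.
  rewrite (bigD1 (word x))//= indicE mem_set// mule1 big1 ?adde0// => w wx.
  by rewrite indicE memNset ?mule0// => /= xw; rewrite xw eqxx in wx.
have ii w : nu.-integrable setT (fun x => (c w)%:E * (\1_(word_cylinder w) x)%:E)%E.
  apply: integrableZl => //; apply: continuous_integrable => //.
  exact: indic_cylindrical_continuous (@word_cylindrical w).
rewrite (funext E); split; first exact: integrable_sum.
rewrite integral_sum//; apply: eq_bigr => w _; rewrite integralZl//.
  by rewrite integral_indic// setIT.
apply: continuous_integrable => //.
exact: indic_cylindrical_continuous (@word_cylindrical w).
Qed.

End words.

Lemma integral_dist_le nu f g (e : R) : nu setT = 1%E ->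
  nu.-integrable setT (EFin \o f) -> nu.-integrable setT (EFin \o g) ->
  (forall x, `|f x - g x| <= e) ->
  `|fine (\int[nu]_x (f x)%:E)%E - fine (\int[nu]_x (g x)%:E)%E| <= e.
Proof.
move=> nuT fi gi fg.
have fgi : nu.-integrable setT (fun x => (f x)%:E - (g x)%:E)%E by exact: integrableB.
rewrite -fineB ?integrable_fin_num// -integralB//.
rewrite -lee_fin -abse_EFin fineK ?integrable_fin_num//.
apply: (le_trans (le_abse_integral nu measurableT (measurable_int _ fgi))).
rewrite -[leRHS]mule1 -nuT -integral_cst//.
apply: ge0_le_integral => //.
- exact: measurable_int (integrable_abse fgi).
- by move=> x _; rewrite -EFinB lee_fin.
Qed.

(** Cylindrical sets are clopen, so their indicators are continuous test functions. *)
Lemma generic_frequency (mu : probability (borel X) R) x n U :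
  generic_points mu x -> cylindrical n U -> frequency x U @ \oo --> fine (mu U).
Proof.
move=> gx Un; have mU := cylindrical_borel Un.
have : (\int[empirical R x k]_y (\1_U y)%:E)%E @[k --> \oo] --> (fine (mu U))%:E.
  rewrite fineK ?fin_num_measure// -[X in mu X]setIT -(integral_indic mu measurableT mU).
  exact: gx (indic_cylindrical_continuous Un).
move=> /fine_cvgP[_]; apply: cvg_trans; apply: near_eq_cvg; exists 0%N => // k _ /=.
by rewrite integral_indic// setIT empiricalE.
Qed.

(** Up to e / 3, uniformly, a continuous f depends on the first n letters only, and integrals of
    such functions are finite combinations of measures of word cylinders. *)
Lemma frequency_generic (mu : probability (borel X) R) x :
  (forall n (w : {ffun 'I_n -> A}), frequency x (word_cylinder w) @ \oo -->
     fine (mu (word_cylinder w))) -> generic_points mu x.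
Proof.
move=> freq f fc.
have muT : mu setT = 1%E by exact: probability_setT.
have muoo : (mu setT < +oo)%E by rewrite muT ltry.
have muf : mu.-integrable setT (EFin \o f) by exact: continuous_integrable muoo fc.
(* Time 0 is excluded, since the empirical measure there is zero. *)
have nuT k : (0 < k)%N -> empirical R x k setT = 1%E.
  by move=> k0; rewrite empiricalE frequencyT.
rewrite -[X in _ --> X]fineK ?integrable_fin_num//; apply/fine_cvgP; split.
  exists 1%N => // k /nuT k1; apply: integrable_fin_num => //.
  by apply: (continuous_integrable _ fc); rewrite k1 ltry.
apply/cvgrPdist_le => e e0; have e3 : 0 < e / 3 by rewrite divr_gt0.
have [n fn] := uniformly_continuous_subshift fc e3.
have [c cf] : exists c : {ffun 'I_n -> A} -> R, forall y, `|f y - c (word n y)| <= e / 3.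
  (* The value at some point of the cylinder, or 0 for words that start no point of X. *)
  exists (fun w => if pselect (exists y, word n y = w) is left h then f (sval (cid h)) else 0) => y.
  case: pselect => [h|[]]; last by exists y.
  by apply/fn/agree_word/esym; exact: svalP (cid h).
pose S (nu : {measure set (borel X) -> \bar R}) := fine (\int[nu]_y (c (word n y))%:E)%E.
have SE (nu : {measure set (borel X) -> \bar R}) : (nu setT < +oo)%E ->
    S nu = \sum_w c w * fine (nu (word_cylinder w)).
  move=> nuT'; rewrite /S (integral_word c nuT').2.
  rewrite (eq_bigr (fun w => (c w * fine (nu (word_cylinder w)))%:E)) ?sumEFin// => w _.
  rewrite EFinM fineK// (lty_fin_num_fun nuT')//.
  exact: cylindrical_borel (@word_cylindrical n w).
have Sc : S (empirical R x k) @[k --> \oo] --> S mu.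
  rewrite (SE mu muoo).
  have : \sum_w c w * frequency x (word_cylinder w) k @[k --> \oo] -->
      \sum_w c w * fine (mu (word_cylinder w)).
    apply: cvg_big => [|w _]; [exact: add_continuous|]; apply: cvgM; first exact: cvg_cst.
    exact: freq.
  apply: cvg_trans; apply: near_eq_cvg; exists 1%N => // k /nuT k1 /=.
  rewrite SE ?k1 ?ltry//; apply: eq_bigr => w _; by rewrite empiricalE.
have near_int (nu : {measure set (borel X) -> \bar R}) : nu setT = 1%E ->
    `|fine (\int[nu]_y (f y)%:E)%E - S nu| <= e / 3.
  move=> nu1; have nuoo : (nu setT < +oo)%E by rewrite nu1 ltry.
  apply: integral_dist_le => //; first exact: continuous_integrable.
  exact: (integral_word c nuoo).1.
near=> k.
have k1 : empirical R x k setT = 1%E by apply: nuT; near: k; exact: nbhs_infty_gt.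
have h1 := near_int _ muT; have h2 := near_int _ k1.
have h3 : `|S mu - S (empirical R x k)| <= e / 3.
  by near: k; move/cvgrPdist_le: Sc; apply.
move: h1 h2 h3; rewrite !ler_norml => /andP[? ?] /andP[? ?] /andP[? ?].
apply/andP; split; rewrite /=; lra.
Unshelve. all: by end_near. Qed.

End generic_points.

(** * Borel complexity of generic points and a criterion for ergodicity *)

Section subshift_measures.
Variables (A : finType) (X : subshift A) (R : realType).
Local Notation val := (@set_val _ (subshift_set X)).
Local Notation T := (@subshift_map _ X).
Implicit Types (mu : probability (borel X) R) (x y : X).

Lemma agree_iter n j x y : agree (n + j) (val x) (val y) ->
  agree n (val (iter j T x)) (val (iter j T y)).
Proof. by move=> xy i iN; rewrite !val_iter_map xy// addnC ltn_add2r. Qed.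

Lemma frequency_agree n U k x y : cylindrical n U -> agree (n + k) (val x) (val y) ->
  frequency R x U k = frequency R y U k.
Proof.
move=> Un xy; rewrite /frequency; congr (_ * _%:R); apply: eq_bigr => j _; congr nat_of_bool.
have {}xy : agree n (val (iter j T x)) (val (iter j T y)).
  by apply/agree_iter/agreeW/xy; rewrite leq_add2l ltnW.
apply/idP/idP => /set_mem h; apply/mem_set; [exact: Un xy h|by apply: Un h => i /xy].
Qed.

(** Genericity is a countable intersection, over words and tolerances, of the unions over N of the
    sets [bad p N]. These are closed, since a frequency at time j depends on finitely many
    letters. *)
Lemma Pi03_generic_points mu : Pi0 3 (generic_points mu).
Proof.
pose I := ({n : nat & {ffun 'I_n -> A}} * nat)%type.
pose bad (p : I) N := [set x : X | forall j, (N <= j)%N ->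
  `|frequency R x (word_cylinder (tagged p.1)) j -
    fine (mu (word_cylinder (tagged p.1)))| <= p.2.+1%:R^-1].
(* Numbers that code no pair contribute the empty set. *)
exists (fun i => if (unpickle i : option I) is Some p then ~` (\bigcup_N bad p N) else set0).
  move=> i; case: (unpickle i) => [p|]; last first.
    by rewrite setC0; exists (fun=> setT); [move=> j; rewrite setCT; exact: open0|rewrite bigcup_const].
  rewrite setCK; exists (bad p) => // N.
  apply/open_subshiftP => x /existsNP[j /not_implyP[Nj hj]].
  exists (tag p.1 + j)%N => y xy /(_ j Nj); apply: contra_not hj.
  by rewrite (frequency_agree (@word_cylindrical _ _ _ (tagged p.1)) xy).
apply/seteqP; split=> x.
  apply: contra_notP => nx; apply: frequency_generic => n w.
  apply/cvgrPdist_le => e e0.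
  pose p : I := (Tagged (fun n => {ffun 'I_n -> A}) w, Num.truncn e^-1).
  have : (\bigcup_N bad p N) x.
    apply: contrapT => h; apply: nx; exists (pickle p) => //.
    by rewrite pickleK.
  move=> [N _ hN]; exists N => // j /= Nj; rewrite distrC (le_trans (hN j Nj))//.
  by rewrite invf_ple ?posrE// ltW// truncnS_gt.
move=> [i _]; case: (unpickle i) => // p nb gx; apply: nb.
have /cvgrPdist_le/(_ p.2.+1%:R^-1) := generic_frequency gx (@word_cylindrical _ _ _ (tagged p.1)).
by rewrite invr_gt0 ltr0n => /(_ isT)[N _ hN]; exists N => // j Nj; rewrite distrC; exact: hN.
Qed.

Lemma shift_invariant_of_cylinders mu :
  (forall n U, cylindrical n U -> mu (T @^-1` U) = mu U) -> shift_invariant mu.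
Proof.
have mT := @subshift_map_measurable A X.
move=> h; apply: (@eq_borel_measure A X R (pushforward mu (T : borel X -> borel X)) mu) => //.
suff : (mu setT < +oo)%E by [].
by rewrite probability_setT ltry.
Qed.

Lemma preimage_iterS j (B : set X) : iter j.+1 T @^-1` B = T @^-1` (iter j T @^-1` B).
Proof. by apply/seteqP; split=> x; rewrite /preimage /mkset iterSr. Qed.

Lemma measure_preimage_iter mu j B : shift_invariant mu -> measurable (B : set (borel X)) ->
  measurable (iter j T @^-1` B : set (borel X)) /\ mu (iter j T @^-1` B) = mu B.
Proof.
move=> inv mB; elim: j => [//|j [mj ej]].
rewrite preimage_iterS.
split; last by rewrite inv.
by rewrite -[X in measurable X]setTI; exact: subshift_map_measurable.
Qed.

(** A point of an invariant B visits U as often as it visits the intersection of B and U, so the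
    deviation bound shows that this intersection has measure at most [mu B * mu U]. Passing to
    complements gives equality; uniqueness of measures extends it from U to all Borel sets, and the
    case of B itself shows that [mu B] is its own square. *)
Lemma ergodic_of_cylinders mu : shift_invariant mu ->
  (forall n U (e : R), cylindrical n U -> 0 < e -> exists2 s, (0 < s)%N &
    (mu [set x : X | (fine (mu U) + e < frequency R x U s)%R] <= e%:E)%E) ->
  ergodic mu.
Proof.
move=> inv dev; split=> // B mB TB.
pose m (U : set (borel X)) := fine (mu U).
have TjB j : iter j T @^-1` B = B.
  by elim: j => // j IH; rewrite preimage_iterS IH.
have up n U : cylindrical n U -> m (B `&` U) <= m B * m U.
  move=> Un; have mU := cylindrical_borel Un.
  apply/ler_addgt0Pl => e e0; have e2 : 0 < e / 2 by rewrite divr_gt0.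
  have [s s0 hs] := dev n U _ Un e2.
  set D := [set x | _] in hs.
  have mD : measurable (D : set (borel X)).
    apply: (@cylindrical_borel _ _ (n + s)%N) => x y xy.
    by rewrite /D /= (frequency_agree Un xy).
  pose E j := iter j T @^-1` (U `&` B).
  have mE j : measurable (E j : set (borel X)) /\ mu (E j) = (m (B `&` U))%:E.
    have mUB : measurable (U `&` B : set (borel X)) by exact: measurableI.
    have [? ->] := measure_preimage_iter j inv mUB; split=> //.
    by rewrite /m fineK 1?setIC// fin_num_measure//; exact: measurableI.
  pose a := s%:R * (m U + e / 2).
  have m_ge0 V : 0 <= m V by rewrite fine_ge0.
  have sR : 0 < s%:R :> R by rewrite ltr0n.
  have intE j : mu.-integrable setT (fun x => (\1_(E j) x)%:E) by exact: integrable_indic (mE j).1.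
  have intB : mu.-integrable setT (fun x => a%:E * (\1_B x)%:E)%E.
    by apply: integrableZl => //; exact: integrable_indic.
  have intD : mu.-integrable setT (fun x => s%:R%:E * (\1_D x)%:E)%E.
    by apply: integrableZl => //; exact: integrable_indic.
  (* Outside B no term counts; in B there are at most a visits off D, and trivially at most s on
     D. *)
  have : (\int[mu]_x (\sum_(j < s) (\1_(E j) x)%:E) <=
      \int[mu]_x (a%:E * (\1_B x)%:E + s%:R%:E * (\1_D x)%:E))%E.
    apply: le_integral => //; [exact: integrable_sum|exact: integrableD|].
    move=> x _; rewrite sumEFin -!EFinM -EFinD lee_fin !indicE.
    have a0 : 0 <= a by rewrite mulr_ge0 ?addr_ge0 ?(ltW e2).
    have [xB|xB] := boolP (x \in B); last first.
      rewrite big1 ?mulr0 ?add0r ?mulr_ge0// => j _; rewrite indicE memNset// => -[_ xj].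
      have : (iter j T @^-1` B) x by [].
      by rewrite TjB => /mem_set; rewrite (negPf xB).
    have Ej (j : 'I_s) : \1_(E j) x = (iter j T x \in U)%:R :> R.
      rewrite indicE; congr (_%:R); congr nat_of_bool; apply/idP/idP => /set_mem.
        by move=> [? _]; exact/mem_set.
      move=> ?; apply/mem_set; split => //.
      suff : (iter j T @^-1` B) x by []. by rewrite TjB; exact/set_mem.
    rewrite (eq_bigr _ (fun j _ => Ej j)) -natr_sum mulr1.
    have [xD|xD] := boolP (x \in D).
      rewrite mulr1 (le_trans (_ : _ <= s%:R)) ?lerDr// ler_nat.
      by rewrite -[X in (_ <= X)%N]card_ord -sum1_card leq_sum// => j _; exact: leq_b1.
    rewrite mulr0 addr0 /a -ler_pdivrMl//.
    by rewrite leNgt; apply: contra xD => ?; exact/mem_set.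
  rewrite integral_sum// integralD//.
  have IZ (c : R) V : measurable (V : set (borel X)) ->
      (\int[mu]_x (c%:E * (\1_V x)%:E) = c%:E * mu V)%E.
    move=> mV; have iV : mu.-integrable setT (fun x => (\1_V x)%:E) by apply: integrable_indic; exact: mV.
    rewrite (integralZl measurableT iV).
    by rewrite integral_indic ?setIT.
  rewrite !IZ//.
  rewrite (eq_bigr (fun=> (m (B `&` U))%:E)); last first.
    by move=> j _; have [mj ej] := mE j; rewrite (integral_indic mu measurableT mj) setIT.
  rewrite sumEFin sumr_const card_ord -[m _ *+ _]mulr_natl.
  rewrite -(fineK (fin_num_measure mu B mB)) -(fineK (fin_num_measure mu D mD)).
  rewrite -!EFinM -EFinD lee_fin => h.
  have hD : fine (mu D) <= e / 2 by rewrite -lee_fin fineK ?fin_num_measure.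
  have mB1 : m B <= 1 by rewrite -lee_fin fineK ?fin_num_measure ?probability_le1.
  rewrite -(ler_pM2l sR) (le_trans h)//.
  have : s%:R * fine (mu D) <= s%:R * (e / 2) by rewrite ler_pM2l.
  have : s%:R * (e / 2) * m B <= s%:R * (e / 2) * 1 by rewrite ler_wpM2l// mulr_ge0// ltW.
  rewrite /a /m; lra.
have eqm n U : cylindrical n U -> m (B `&` U) = m B * m U.
  move=> Un; have mU := cylindrical_borel Un.
  have mUC : m (~` U) = 1 - m U by rewrite /m probability_setC// fineB ?fin_num_measure.
  have mBU : m (B `&` U) + m (B `&` ~` U) = m B.
    have mBU' : measurable (B `&` U : set (borel X)) by exact: measurableI.
    have mBC : measurable (B `&` ~` U : set (borel X)).
      by apply: measurableI => //; exact: measurableC.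
    rewrite /m -fineD ?fin_num_measure// -measureU//; last first.
      by rewrite setIACA setICr setI0.
    by rewrite -setIUr setUv setIT.
  have h1 := up _ _ Un; have h2 := up _ _ (cylindricalC Un).
  apply/eqP; rewrite eq_le h1 /=; move: h2; rewrite mUC; lra.
have b0 : 0 <= m B by rewrite fine_ge0.
have BB : m B = m B * m B.
  have hT : (mrestr mu mB setT < +oo)%E.
    by rewrite /mrestr setTI -(fineK (fin_num_measure mu B mB)) ltry.
  have hC n U : cylindrical n U -> mrestr mu mB U = mscale (NngNum b0) mu U.
    move=> Un; have mU := cylindrical_borel Un.
    have mBU : measurable (B `&` U : set (borel X)) by exact: measurableI.
    rewrite /mrestr /mscale /= setIC -(fineK (fin_num_measure mu _ mBU)).
    by rewrite -/(m _) (eqm n)// EFinM [(m U)%:E]fineK ?fin_num_measure.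
  have : (mu (B `&` B) = (m B)%:E * mu B)%E.
    exact: (@eq_borel_measure A X R (mrestr mu mB) (mscale (NngNum b0) mu) hT hC B mB).
  rewrite setIid -(fineK (fin_num_measure mu B mB)) -EFinM.
  by case.
have : m B * (1 - m B) = 0 by rewrite mulrBr mulr1 -BB subrr.
move=> /eqP; rewrite mulf_eq0 => /orP[/eqP B0|/eqP B1]; [left|right].
  by rewrite -(fineK (fin_num_measure mu B mB)) -/(m B) B0.
by rewrite -(fineK (fin_num_measure mu B mB)) -/(m B); congr _%:E; lra.
Qed.

End subshift_measures.

(** * The Morse subshift *)

(** This is the orbit closure of [mseq]. *)
Definition morse_set : set (full_shift bool) :=
  [set x | forall n, exists t, agree n x (fun s => mseq (t + s))].

Lemma morse_set_mseq t : morse_set (fun s => mseq (t + s)).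
Proof. by move=> n; exists t. Qed.

Lemma morse_set_closed : closed morse_set.
Proof.
rewrite -openC openE => x /existsNP[n hn]; apply/nbhs_full_shift; exists n => y xy /(_ n)[t yt].
by apply: hn; exists t => i iN; rewrite xy// yt.
Qed.

Lemma morse_set_shift : @Defs.shift bool @` morse_set `<=` morse_set.
Proof.
move=> _ [x xM <-] n; have [t xt] := xM n.+1; exists t.+1 => i iN.
by rewrite /Defs.shift xt// addSnnS.
Qed.

Definition morse : subshift bool :=
  Subshift (ex_intro _ _ (morse_set_mseq 0)) morse_set_closed morse_set_shift.

Local Notation val := (@set_val _ (subshift_set morse)).
Local Notation T := (@subshift_map _ morse).

Definition morse_point (x : full_shift bool) (xM : morse_set x) : morse :=
  exist (fun x => x \in subshift_set morse) x (mem_set xM).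

Definition orbit_point t : morse := morse_point (morse_set_mseq t).

Lemma val_orbit_point t i : val (orbit_point t) i = mseq (t + i).
Proof. by []. Qed.

Lemma subshift_inj (x y : morse) : (forall i, val x i = val y i) -> x = y.
Proof. by move=> xy; apply/val_inj/funext. Qed.

Lemma iter_orbit_point j t : iter j T (orbit_point t) = orbit_point (t + j).
Proof. by apply: subshift_inj => i; rewrite val_iter_map !val_orbit_point addnA. Qed.

(** A word of y lies in some prefix B_k of [mseq], and by [mseq_recurrent] every window of length
    [2 * scale k.+1] contains B_k; so the word occurs in every x. *)
Lemma minimal_morse : minimal_subshift morse.
Proof.
move=> x; apply/seteqP; split=> // y _ U /nbhs_subshift[n nU].
have occurs (z : morse) k : exists t, agree k (val z) (fun s => mseq (t + s)).
  exact: set_mem (valP z) k.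
have [t yt] := occurs y n; have [t' xt] := occurs x (2 * scale (t + n).+1)%N.
have [t0 [h1 h2 h3]] := mseq_recurrent (t + n) t'.
exists (iter (t0 - t' + t) T x); split; first by exists (t0 - t' + t)%N.
apply: nU => i iN; rewrite val_iter_map (yt i iN).
have tin : (t + i < scale (t + n))%N by rewrite (leq_trans _ (ltnW (scale_gtn _)))// ltn_add2l.
have E : (t' + (t0 - t' + t + i) = t0 + (t + i))%N by lia.
by rewrite [RHS]xt ?E ?h3//; lia.
Qed.

Definition visits (U : set morse) : pred nat := fun t => `[< U (orbit_point t) >].

Lemma visits_local n U : cylindrical n U -> local n (visits U).
Proof.
move=> Un t t' h; apply: asbool_equiv_eq; split; apply: Un => i iN; [exact: h|exact/esym/h].
Qed.

(** * The invariant measure and the genericity of encoded points *)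

Section measure.
Variable R : realType.

Lemma morse_measure : exists mu : probability (borel morse) R,
  forall n U, cylindrical n U -> mu U = (mean R (visits U))%:E.
Proof.
have mE n U : cylindrical n U -> `|mean R (visits U)| = mean R (visits U).
  by move=> /visits_local h; rewrite ger0_norm// (mean_ge0 _ h).
(* The extension asks for nonnegativity on all sets, while means are known to be nonnegative for
   local predicates; hence the absolute value. *)
have [|||mu hmu] := @cylinder_extension _ morse R (fun U => `|mean R (visits U)|).
- by move=> U; exact: normr_ge0.
- have -> : visits setT = predC pred0 by apply/funext => t; exact: asboolT.
  by rewrite (@meanC _ 0)// mean_pred0 subr0 normr1.
- move=> n U V Un Vn UV; rewrite !(mE n)//; last exact: cylindricalU.
  have -> : visits (U `|` V) = predU (visits U) (visits V).
    by apply/funext => t; exact: asbool_or.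
  apply: mean_predU (visits_local Un) (visits_local Vn) _ => t.
  by apply/negP => /andP[/asboolP Ut /asboolP Vt]; have : (U `&` V) (orbit_point t) by []; rewrite UV.
by exists mu => n U Un; rewrite (hmu n)// (mE n).
Qed.

Variable mu : probability (borel morse) R.
Hypothesis muE : forall n U, cylindrical n U -> mu U = (mean R (visits U))%:E.

Lemma morse_invariant : shift_invariant mu.
Proof.
apply: shift_invariant_of_cylinders => n U Un.
rewrite (muE (cylindrical_shift Un)) (muE Un) -(mean_shift _ (visits_local Un)).
congr (mean R _)%:E; apply/funext => t; rewrite /visits.
by rewrite /preimage /mkset -[T _]/(iter 1 T _) iter_orbit_point addn1.
Qed.

Lemma sum_visits U t s : (\sum_(j < s) (iter j T (orbit_point t) \in U) =
  \sum_(j < s) visits U (t + j))%N.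
Proof. by apply: eq_bigr => j _; rewrite iter_orbit_point. Qed.

Lemma morse_ergodic : ergodic mu.
Proof.
apply: ergodic_of_cylinders; first exact: morse_invariant.
move=> n U e Un e0; have [s s0 hs] := mean_deviation (visits_local Un) e0.
exists s => //; rewrite (muE Un) /= (@muE (n + s)); last first.
  by move=> x y xy; rewrite /= (frequency_agree _ Un xy).
rewrite lee_fin; apply: le_trans hs; rewrite le_eqVlt; apply/predU1l; congr (mean R _).
apply/funext => t; rewrite /visits /= /frequency sum_visits.
rewrite -[RHS]asboolb; congr asbool; congr is_true.
by rewrite ltr_pdivlMl// ltr0n.
Qed.

Lemma encode_morse y : morse_set (encode y).
Proof.
move=> n; exists (start y n) => i iN; rewrite (@encodeE _ _ n)//.
exact: ltn_trans (remaining_gt y n).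
Qed.

Definition encode_point y : morse := morse_point (encode_morse y).

Lemma val_encode_point y i : val (encode_point y) i = encode y i.
Proof. by []. Qed.

Lemma agree_encode n y z : agree n y z -> agree n (encode y) (encode z).
Proof.
move=> yz i iN; rewrite /encode /start; congr (mseq (_ + _)%N).
by apply: eq_bigr => j _; rewrite /digit /gap yz// (ltn_trans (ltn_ord j)).
Qed.

Lemma encode_point_continuous y (U : set morse) : open U -> U (encode_point y) ->
  exists n, forall z, agree n y z -> U (encode_point z).
Proof.
by move=> /open_subshiftP oU /oU[n nU]; exists n => z /agree_encode yz; exact: nU.
Qed.

Lemma generic_encode_point y : generic_points mu (encode_point y) <->
  forall K, exists N, forall n, (N <= n)%N -> (K <= y n)%N.
Proof.
split=> [gy|yoo].
  (* One letter detects the failure: the visits to U are [mseq] itself. *)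
  pose U := [set x : morse | val x 0%N = true].
  have U1 : cylindrical 1 U by move=> x z xz; rewrite /U /= -xz.
  apply: (@encode_nongeneric R); have := generic_frequency gy U1.
  rewrite (muE U1) /=; have -> : visits U = mseq.
    by apply/funext => t; rewrite /visits /U /= val_orbit_point addn0; exact: asboolb.
  apply: cvg_trans; apply: near_eq_cvg; exists 0%N => // s _.
  rewrite /frequency mulrC; congr (_%:R / _); apply: eq_bigr => j _; congr nat_of_bool.
  rewrite -val_encode_point -[X in val _ X]addn0 -val_iter_map.
  by apply/idP/idP => [/set_mem//|h]; exact/mem_set.
apply: frequency_generic => n w; have wn := @word_cylindrical _ morse n w.
rewrite (muE wn) /=; set U := word_cylinder w in wn *.
apply/cvgrPdist_le => e e0.
have [S hS] := encode_generic yoo (visits_local wn) e0.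
exists S.+1 => // s /= Ss; have sR : 0 < s%:R :> R by rewrite ltr0n; case: s Ss.
(* Level [s + n] covers the windows of length n at the first s times. *)
have := hS s (s + n)%N (ltnW Ss) (ltnW (leq_ltn_trans (leq_addr _ _) (remaining_gt _ _))).
have -> : (\sum_(j < s) visits U (start y (s + n) + j) =
    \sum_(j < s) (iter j T (encode_point y) \in U))%N.
  apply: eq_bigr => j _; congr nat_of_bool.
  have a : agree n (val (iter j T (encode_point y))) (val (orbit_point (start y (s + n) + j))).
    move=> i iN; rewrite val_iter_map val_encode_point val_orbit_point (@encodeE _ _ (s + n)) ?addnA//.
    by rewrite (leq_trans _ (ltnW (remaining_gt _ _)))//; have := ltn_ord j; lia.
  apply/asboolP/idP => [h|/set_mem h]; [apply/mem_set|]; apply: wn h => // i /a//.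
move=> h; rewrite -(ler_pM2l sR) (le_trans _ h)//.
set N := (\sum_(j < s) _)%N; rewrite [_%:R - _](_ : _ = - (s%:R * (mean R (visits U) - s%:R^-1 * N%:R))).
  by rewrite normrN normrM ger0_norm ?(ltW sR).
by field; rewrite gt_eqF.
Qed.

End measure.

Theorem theorem35 (R : realType) :
  exists (A : finType) (X : subshift A) (mu : probability (borel X) R),
    minimal_subshift X /\ ergodic mu /\ Pi03_complete (generic_points mu).
Proof.
have [mu muE] := morse_measure R.
exists bool, morse, mu; split; first exact: minimal_morse.
split; first exact: morse_ergodic.
split; first exact: Pi03_generic_points.
exact: not_Sigma03_of_reduction (@encode_point_continuous) (generic_encode_point muE).
Qed.
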